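(* Let $\rho:\mathbb{C}\times\mathbb{R}\to\mathbb{R}$ be a smooth function such that the graph $$S=\{(z,w)\in\mathbb{C}^2: v=\rho(z,u)\},\qquad w=u+iv,$$ is Levi flat. Suppose that $|\rho|$ is bounded by some constant $M$. Then $S$ is foliated by complex lines, i.e. $\rho$ has the form $\rho(z,u)=\varrho(u)$ for some smooth function $\varrho:\mathbb{R}\to\mathbb{R}$.
   Context: Coordinates on $\mathbb{C}^2$ are $(z,w)$ with $z=x+iy$, $w=u+iv$. A smooth real hypersurface of $\mathbb{C}^2$ is Levi flat if it is foliated by (immersed) complex curves; equivalently, its Levi form vanishes identically. *)

(* Defs.v *)
From Stdlib Require Import Reals Relations.
From Coquelicot Require Import Coquelicot.

Open Scope R_scope.

(** [C * R] and [C * C] as real normed spaces; Coquelicot's default structure on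
    [C] is the complex one, so the real one has to be named. *)
Definition CxR : NormedModule R_AbsRing :=
  prod_NormedModule R_AbsRing C_R_NormedModule R_NormedModule.
Definition CxC : NormedModule R_AbsRing :=
  prod_NormedModule R_AbsRing C_R_NormedModule C_R_NormedModule.

Section Smoothness.
Context {V W : NormedModule R_AbsRing}.

(** Class C^k on [D], meant for [D] open and [V] finite dimensional: there, [f] is
    C^(k+1) iff its derivative in every fixed direction exists on [D] and is C^k. *)
Fixpoint Ck_on (k : nat) (D : V -> Prop) (f : V -> W) : Prop :=
  match k with
  | O => forall x, D x -> continuous f x
  | S k' => forall v : V, exists g : V -> W,
      (forall x, D x ->
         is_derive (K := R_AbsRing) (fun t : R => f (plus x (scal t v))) 0 (g x))
      /\ Ck_on k' D g
  end.

Definition smooth_on (D : V -> Prop) (f : V -> W) : Prop :=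
  forall k, Ck_on k D f.

Definition smooth (f : V -> W) : Prop := smooth_on (fun _ => True) f.
End Smoothness.

Definition holomorphic_on (D : C -> Prop) (f : C -> C) : Prop :=
  forall z, D z -> ex_derive (K := C_AbsRing) (V := C_NormedModule) f z.

Definition unit_disc (z : C) : Prop := Cmod z < 1.
Definition unit_interval (t : R) : Prop := Rabs t < 1.
Definition box (x : C * R) : Prop := unit_disc (fst x) /\ unit_interval (snd x).

(** [phi] is a diffeomorphism of the box onto a relatively open subset of [X] whose
    slices [phi (., t)] are holomorphic.  As in differential topology, a map defined
    on a subset of [C * C] is smooth when it extends smoothly to an open set; this
    applies to the inverse [psi].  The equation [psi (phi x) = x] makes [phi], hence
    each slice, an immersion. *)
Definition flow_box (X : C * C -> Prop) (phi : C * R -> C * C) : Prop :=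
  smooth_on (V := CxR) (W := CxC) box phi
  /\ (forall t, unit_interval t ->
        holomorphic_on unit_disc (fun zeta => fst (phi (zeta, t)))
        /\ holomorphic_on unit_disc (fun zeta => snd (phi (zeta, t))))
  /\ exists (U : C * C -> Prop) (psi : C * C -> C * R),
       open (T := CxC) U
       /\ smooth_on (V := CxC) (W := CxR) U psi
       /\ (forall x, box x -> U (phi x) /\ X (phi x) /\ psi (phi x) = x)
       /\ (forall p, U p -> X p -> box (psi p) /\ phi (psi p) = p).

Definition plaque (phi : C * R -> C * C) (t : R) (p : C * C) : Prop :=
  exists zeta, unit_disc zeta /\ p = phi (zeta, t).

(** A foliated atlas [A] of [X] by complex curves.  In the last clause, a plaque of one
    flow box that meets a plaque of another stays in it near the common point: the
    transition maps have the form [(zeta, t) |-> (h (zeta, t), k t)] locally. *)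
Definition complex_foliation (X : C * C -> Prop)
    (A : (C * R -> C * C) -> Prop) : Prop :=
  (forall phi, A phi -> flow_box X phi)
  /\ (forall p, X p -> exists phi x, A phi /\ box x /\ phi x = p)
  /\ (forall phi phi' zeta t zeta' t',
        A phi -> A phi' -> box (zeta, t) -> box (zeta', t') ->
        phi (zeta, t) = phi' (zeta', t') ->
        exists eps, 0 < eps /\
          forall eta, unit_disc eta -> Cmod (eta - zeta)%C < eps ->
            plaque phi' t' (phi (eta, t))).

(** The leaf through [p] consists of the points that a finite chain of successively
    meeting plaques joins to [p]. *)
Definition same_plaque (A : (C * R -> C * C) -> Prop) (p q : C * C) : Prop :=
  exists phi t, A phi /\ unit_interval t /\ plaque phi t p /\ plaque phi t q.

Definition leaf (A : (C * R -> C * C) -> Prop) (p : C * C) : C * C -> Prop :=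
  clos_trans (C * C) (same_plaque A) p.

Definition levi_flat (X : C * C -> Prop) : Prop :=
  exists A, complex_foliation X A.

Definition complex_line (L : C * C -> Prop) : Prop :=
  exists a b : C * C, b <> (RtoC 0, RtoC 0) /\
    forall p, L p <->
      exists zeta : C, p = (fst a + zeta * fst b, snd a + zeta * snd b)%C.

Definition foliated_by_complex_lines (X : C * C -> Prop) : Prop :=
  exists A, complex_foliation X A /\ forall p, X p -> complex_line (leaf A p).

Definition graph (rho : C * R -> R) (p : C * C) : Prop :=
  Im (snd p) = rho (fst p, Re (snd p)).

(* Main.v *)
(** Fix [w0] at positive distance from all slices [S_z] of the graph.  If a holomorphic
    leaf through a nearest point of [S_z] is [(F, G)], then [- ln |G - w0|] is harmonic
    and touches [- ln (dist (w0, S_z))] from below, so the latter is a subharmonic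
    function of [z] in the viscosity sense.  It is bounded above on the whole plane,
    hence constant, by comparison with a logarithmic barrier.  The distance from [w0]
    to [S_z] is thus the same for all [z].  For fixed [u], let [sigma] be the largest
    [v] with [u + i v] in the closure of the union of all slices; letting [w0] decrease
    to [u + i sigma] shows that [u + i sigma] belongs to every [S_z], that is,
    [rho (z, u) = sigma]. *)

Require Import Defs.
From Stdlib Require Import Reals Lra List Relations ClassicalEpsilon.
From Coquelicot Require Import Coquelicot.

(** * Calculus in normed modules *)

(** The distance to a slice need not be differentiable in [z], and a nearest point need not vary
    continuously. The maximum is therefore taken over [z] and [u] together, for a function on the
    graph itself: [- ln |w - w0|^2 - eta (ln |z - z0|^2 - 1 / |z - z0|^2)]. On the leaf [(F, G)]
    through a maximum both logarithms are harmonic; the term with [1 / |z - z0|^2] breaks the tie,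
    since it gives the Laplacian the value [4 eta |F'|^2 / |F - z0|^4]. A contradiction thus
    requires [F' <> 0], that is, no leaf may be tangent to the [w] direction; a graph over [(z, u)]
    guarantees this. The logarithm of [|z - z0|^2] is unbounded at infinity, which compensates for
    the noncompactness of the plane, while [eta] tends to 0 in effect because it may be chosen after
    the two values to be compared. The other obstacle is that [Ck_on] speaks of directional
    derivatives at single points only. A local Lipschitz bound stands in for the chain rule, and the
    second derivatives of a leaf come from the Cauchy-Riemann equations and the symmetry of mixed
    derivatives. *)

Lemma locally_0_lt (d : R) : 0 < d -> locally 0 (fun s : R => Rabs s < d).
Proof.
  intros Hd; exists (mkposreal d Hd); intros y Hy.
  change (Rabs (y + - 0) < d) in Hy; now rewrite Ropp_0, Rplus_0_r in Hy.
Qed.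

Lemma is_derive_R_iff (f : R -> R) (x l : R) :
  is_derive f x l <->
  forall eps : posreal, locally x (fun y =>
    Rabs (f y - f x - (y - x) * l) <= eps * Rabs (y - x)).
Proof.
  split.
  - intros [_ H]; exact (H x (fun P HP => HP)).
  - intros H; split; [apply (is_linear_scal_l (K := R_AbsRing)) | ].
    intros y Hy; rewrite <- (is_filter_lim_locally_unique x y Hy); exact H.
Qed.

Lemma is_derive_minus_const (g : R -> R) (c s d : R) :
  is_derive g s d -> is_derive (fun s => g s - c) s d.
Proof.
  intros H; replace d with (minus d 0) by (unfold minus, plus, opp; simpl; ring).
  apply (is_derive_minus g (fun _ => c)); [exact H | ].
  apply (is_derive_const (K := R_AbsRing) (V := R_NormedModule) c s).
Qed.

Lemma is_derive_linear {V W : NormedModule R_AbsRing} (L : V -> W) (f : R -> V)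
    (t : R) (d : V) :
  is_linear L -> is_derive f t d -> is_derive (fun s => L (f s)) t (L d).
Proof.
  intros HL Hf; unfold is_derive.
  apply filterdiff_ext_lin with (fun y => L (scal y d)).
  - apply (filterdiff_comp' f L); [exact Hf | now apply filterdiff_linear].
  - intros y; now apply (linear_scal L HL).
Qed.

Lemma is_derive_pair {V W : NormedModule R_AbsRing} (f : R -> V) (g : R -> W)
    (t : R) (df : V) (dg : W) :
  is_derive f t df -> is_derive g t dg ->
  is_derive (V := prod_NormedModule R_AbsRing V W) (fun s => (f s, g s)) t (df, dg).
Proof.
  intros Hf Hg; unfold is_derive.
  apply filterdiff_ext_lin with (fun y => (scal y df, scal y dg)).
  - apply (filterdiff_comp'_2 f g (fun a b => (a, b)) t _ _ (fun a b => (a, b)) Hf Hg).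
    apply filterdiff_ext with (fun x => x); [now intros [] | ].
    apply filterdiff_ext_lin with (fun x => x); [ | now intros []].
    apply filterdiff_linear, is_linear_id.
  - reflexivity.
Qed.

Section Ck_lemmas.
Context {U V W : NormedModule R_AbsRing}.

Lemma Ck_on_linear (L : V -> W) (k : nat) (D : U -> Prop) (f : U -> V) :
  is_linear L -> Ck_on k D f -> Ck_on k D (fun x => L (f x)).
Proof.
  intros HL; revert f; induction k as [|k IH]; simpl; intros f Hf.
  - intros x Dx; apply continuous_comp; [auto | now apply linear_cont].
  - intros v; destruct (Hf v) as [g [Hg Cg]].
    exists (fun x => L (g x)); split; [ | auto].
    intros x Dx; apply is_derive_linear; auto.
Qed.

Lemma Ck_on_pair (k : nat) (D : U -> Prop) (f : U -> V) (g : U -> W) :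
  Ck_on k D f -> Ck_on k D g ->
  Ck_on (W := prod_NormedModule R_AbsRing V W) k D (fun x => (f x, g x)).
Proof.
  revert f g; induction k as [|k IH]; simpl; intros f g Hf Hg.
  - intros x Dx; apply continuous_comp_2; auto.
    apply continuous_ext with (fun x => x); [now intros [] | apply continuous_id].
  - intros v; destruct (Hf v) as [f' [Hf' Cf]], (Hg v) as [g' [Hg' Cg]].
    exists (fun x => (f' x, g' x)); split; [ | auto].
    intros x Dx; apply is_derive_pair; auto.
Qed.

(** An affine map carries the line through [x] along [v] to the line through [A x] along [l v], so
    each directional derivative of the composite is one of [f] precomposed with the same [A], and
    the induction closes. *)
Lemma Ck_on_precomp_affine (k : nat) (D : V -> Prop) (E : U -> Prop)
    (A l : U -> V) (f : V -> W) :
  (forall x, continuous A x) ->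
  (forall x v (t : R), A (plus x (scal t v)) = plus (A x) (scal t (l v))) ->
  (forall x, E x -> D (A x)) ->
  Ck_on k D f -> Ck_on k E (fun x => f (A x)).
Proof.
  intros CA HA HD; revert f; induction k as [|k IH]; simpl; intros f Hf.
  - intros x Ex; apply continuous_comp; auto.
  - intros v; destruct (Hf (l v)) as [g [Hg Cg]].
    exists (fun x => g (A x)); split; [ | auto].
    intros x Ex; apply is_derive_ext with (fun t => f (plus (A x) (scal t (l v)))); auto.
    intros t; now rewrite HA.
Qed.

(** The derivative along [v] is the constant [l v], which is again affine, with linear part zero. *)
Lemma Ck_on_affine (k : nat) (D : U -> Prop) (f l : U -> V) :
  (forall x, continuous f x) ->
  (forall (x v : U) (t : R), f (plus x (scal t v)) = plus (f x) (scal t (l v))) ->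
  Ck_on k D f.
Proof.
  revert f l; induction k as [|k IH]; simpl; intros f l Cf Hf; [auto | ].
  intros v; exists (fun _ => l v); split.
  - intros x _; apply is_derive_ext with (fun t => plus (f x) (scal t (l v))).
    { intros t; now rewrite Hf. }
    assert (H : is_derive (K := R_AbsRing) (fun t : R => plus (f x) (scal t (l v))) 0
                  (plus zero (scal (one : R_AbsRing) (l v)))).
    { apply (is_derive_plus (K := R_AbsRing) (fun _ => f x) (fun t => scal t (l v))).
      - apply (is_derive_const (K := R_AbsRing)).
      - apply (is_derive_scal_l (K := R_AbsRing) (fun t => t)), is_derive_id. }
    rewrite plus_zero_l, scal_one in H; exact H.
  - apply IH with (fun _ => zero).
    + intros x; apply continuous_const.
    + intros x w t; cbv beta; rewrite (scal_zero_r (V := V)); symmetry; apply plus_zero_r.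
Qed.

End Ck_lemmas.

Section Directional.
Context {V : NormedModule R_AbsRing}.

Lemma plus_scal_0 (x e : V) : plus x (scal (0 : R) e) = x.
Proof. rewrite <- (plus_zero_r x) at 2; f_equal; apply (scal_zero_l e). Qed.

(** [Ck_on] supplies derivatives at parameter 0 of a line only; moving the base point gives them at
    every parameter, as the mean value theorem requires. *)
Lemma is_derive_along {W : NormedModule R_AbsRing} (f : V -> W) (x e : V) (s : R) (d : W) :
  is_derive (K := R_AbsRing) (fun t : R => f (plus (plus x (scal s e)) (scal t e))) 0 d ->
  is_derive (K := R_AbsRing) (fun t : R => f (plus x (scal t e))) s d.
Proof.
  intros H.
  apply is_derive_ext with
    (fun t : R => f (plus (plus x (scal s e)) (scal (t - s) e))).
  - intros t; f_equal; rewrite <- plus_assoc; f_equal.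
    rewrite <- (scal_distr_r (V := V) (s : R) (t - s)); f_equal.
    unfold plus; simpl; ring.
  - replace d with (scal (1 : R) d) by apply (scal_one d).
    apply (is_derive_comp (fun u : R => f (plus (plus x (scal s e)) (scal u e)))
             (fun t : R => t - s)).
    + replace (s - s) with 0 by ring; exact H.
    + auto_derive; [exact I | ring].
Qed.

Definition linear_comb (l : list (R * V)) : V :=
  fold_right (fun p a => plus (scal (fst p) (snd p)) a) zero l.
Definition abs_sum (l : list (R * V)) : R :=
  fold_right (fun p a => Rabs (fst p) + a) 0 l.

Lemma abs_sum_ge0 (l : list (R * V)) : 0 <= abs_sum l.
Proof.
  induction l as [|p l IH]; simpl; [lra | ].
  generalize (Rabs_pos (fst p)); lra.
Qed.

Lemma norm_scal_le (s : R) (e : V) : norm (scal s e) <= Rabs s * norm e.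
Proof. exact (norm_scal s e). Qed.

Lemma norm_minus_plus_le (x y v : V) :
  norm (minus (plus x v) y) <= norm (minus x y) + norm v.
Proof.
  replace (minus (plus x v) y) with (plus (minus x y) v); [apply norm_triangle | ].
  unfold minus; rewrite <- !plus_assoc; f_equal; apply plus_comm.
Qed.

(** The displacement is made one direction at a time. Along each leg the directional derivative is
    bounded near [x0] by continuity, and the mean value inequality applies. The base point [x]
    varies because the later legs start from a point already moved. *)
Lemma C1_lipschitz_along (D : V -> Prop) (h : V -> R) (x0 : V) (es : list V) :
  open D -> Ck_on (W := R_NormedModule) 1 D h -> D x0 ->
  exists delta L : R, 0 < delta /\ 0 <= L /\ forall (x : V) (ss : list R),
    norm (minus x x0) < delta -> abs_sum (combine ss es) < delta ->
    Rabs (h (plus x (linear_comb (combine ss es))) - h x) <= L * abs_sum (combine ss es).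
Proof.
  intros HD Hh Dx0; induction es as [|e es IH].
  - exists 1, 0; split; [lra | split; [lra | ]]; intros x ss _ _.
    assert (E : combine ss (@nil V) = nil) by now destruct ss.
    rewrite E; simpl; rewrite plus_zero_r.
    rewrite Rminus_diag, Rabs_R0; lra.
  - destruct IH as [d1 [L1 [Hd1 [HL1 H1]]]].
    destruct (Hh e) as [g [Hg Cg]]; simpl in Cg.
    assert (Nb : locally x0 (fun x => D x /\ Rabs (g x) <= Rabs (g x0) + 1)).
    { apply filter_and; [now apply HD | ].
      generalize (proj1 (filterlim_locally_ball_norm g (g x0)) (Cg x0 Dx0) (mkposreal 1 Rlt_0_1)).
      apply filter_imp; intros x; unfold ball_norm; simpl; intros Hx.
      change (Rabs (g x - g x0) < 1) in Hx.
      replace (g x) with (g x0 + (g x - g x0)) by ring.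
      generalize (Rabs_triang (g x0) (g x - g x0)); lra. }
    apply locally_norm_le_locally in Nb; destruct Nb as [d2 Hd2].
    set (K := Rabs (g x0) + 1) in *.
    assert (HK : 0 < K) by (unfold K; generalize (Rabs_pos (g x0)); lra).
    assert (Hne : 0 <= norm e) by apply norm_ge_0.
    (* Then [d + d * norm e] is half of [Rmin d1 d2], so the whole leg along [e] stays within both
       radii. *)
    set (d := Rmin d1 d2 / (2 * (1 + norm e))).
    assert (Hm : 0 < Rmin d1 d2) by (apply Rmin_pos; [lra | apply cond_pos]).
    assert (Hd : 0 < d) by (apply Rdiv_lt_0_compat; lra).
    assert (Hdm : d * (1 + norm e) = Rmin d1 d2 / 2) by (unfold d; field; lra).
    assert (Hdd : d <= Rmin d1 d2 / 2) by nra.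
    assert (Hm1 := Rmin_l d1 d2); assert (Hm2 := Rmin_r d1 d2).
    exists d, (K + L1); split; [exact Hd | split; [lra | ]].
    intros x ss Hx Hs; destruct ss as [|s ss]; simpl.
    { rewrite plus_zero_r, Rminus_diag, Rabs_R0; lra. }
    simpl in Hs; assert (Hs0 := abs_sum_ge0 (combine ss es)); assert (Hsp := Rabs_pos s).
    rewrite plus_assoc; set (y := plus x (scal s e)).
    assert (Hseg : forall t, Rabs t <= Rabs s ->
              norm (minus (plus x (scal t e)) x0) < Rmin d1 d2).
    { intros t Ht; eapply Rle_lt_trans; [apply norm_minus_plus_le | ].
      generalize (norm_scal_le t e); intros Hn.
      assert (Rabs t * norm e <= d * norm e) by (apply Rmult_le_compat_r; lra). lra. }
    assert (A2 : Rabs (h y - h x) <= K * Rabs s).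
    { generalize (bounded_variation (fun t => h (plus x (scal t e)))
                    (fun t => g (plus x (scal t e))) K 0 s).
      rewrite Rminus_0_r; intros Hb.
      replace (h x) with (h (plus x (scal (0 : R) e)))
        by now rewrite plus_scal_0.
      apply Hb; intros t; rewrite Rminus_0_r; intros Ht.
      assert (Hin : ball_norm x0 d2 (plus x (scal t e)))
        by (unfold ball_norm; specialize (Hseg t Ht); lra).
      destruct (Hd2 _ Hin) as [Dt Bt]; split; [ | exact Bt].
      apply is_derive_along; apply Hg, Dt. }
    assert (A3 := H1 y ss ltac:(specialize (Hseg s (Rle_refl _)); unfold y; lra)
                    ltac:(lra)).
    assert (T : forall p q r : R, Rabs (p - r) <= Rabs (p - q) + Rabs (q - r)).
    { intros p q r; replace (p - r) with ((p - q) + (q - r)) by ring; apply Rabs_triang. }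
    eapply Rle_trans; [apply (T _ (h y)) | ].
    fold y in A3 |- *.
    assert (0 <= K * abs_sum (combine ss es)) by (apply Rmult_le_pos; lra).
    assert (0 <= L1 * Rabs s) by (apply Rmult_le_pos; lra).
    lra.
Qed.

Lemma norm_minus_diag (x : V) : norm (minus x x) = 0.
Proof.
  replace (minus x x) with (zero : V) by (symmetry; exact (plus_opp_r x)).
  apply norm_zero.
Qed.

Lemma abs_sum_derive_0 (cs : list (R -> R)) (es : list V) :
  List.Forall (fun c => c 0 = 0 /\ is_derive c 0 0) cs ->
  forall eps : posreal, locally 0 (fun s =>
    abs_sum (combine (map (fun c => c s) cs) es) <= eps * Rabs s).
Proof.
  intros Hc; revert es; induction Hc as [|c cs [Hc0 Hc1] _ IH]; intros es eps.
  - simpl; apply filter_forall; intros s.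
    apply Rmult_le_pos; [apply Rlt_le, cond_pos | apply Rabs_pos].
  - destruct es as [|e es]; simpl.
    { apply filter_forall; intros s.
      apply Rmult_le_pos; [apply Rlt_le, cond_pos | apply Rabs_pos]. }
    generalize (filter_and _ _ (proj1 (is_derive_R_iff c 0 0) Hc1 (pos_div_2 eps))
                  (IH es (pos_div_2 eps))).
    apply filter_imp; intros s [H1 H2]; simpl in H1, H2.
    rewrite Hc0, Rmult_0_r, !Rminus_0_r in H1.
    unfold abs_sum in *; simpl in *; lra.
Qed.

(** By the Lipschitz bound, a displacement that is [o(s)] changes [h] by [o(s)]. For stationary
    curves this replaces the chain rule in several variables, and [slice_immersed] is arranged to
    meet only such curves. *)
Lemma C1_curve_derive_0 (D : V -> Prop) (h : V -> R) (x0 : V) (es : list V)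
    (cs : list (R -> R)) :
  open D -> Ck_on (W := R_NormedModule) 1 D h -> D x0 ->
  List.Forall (fun c => c 0 = 0 /\ is_derive c 0 0) cs ->
  is_derive (fun s : R => h (plus x0 (linear_comb (combine (map (fun c => c s) cs) es)))) 0 0.
Proof.
  intros HD Hh Dx0 Hc.
  destruct (C1_lipschitz_along D h x0 es HD Hh Dx0) as [delta [L [Hd [HL H]]]].
  assert (E0 : linear_comb (combine (map (fun c => c 0) cs) es) = zero).
  { clear H; revert es; induction Hc as [|c cs [Hc0 _] _ IH]; intros es; [reflexivity | ].
    destruct es as [|e es]; [reflexivity | ].
    simpl; rewrite Hc0.
    assert (Z : scal (0 : R) e = zero) by apply (scal_zero_l e).
    rewrite Z, plus_zero_l; apply IH. }
  apply is_derive_R_iff; intros eps; rewrite E0, plus_zero_r.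
  (* The first bound turns [L * A] into at most [eps * Rabs s]; the second, together with
     [Rabs s < 1], keeps the displacement below [delta]. *)
  assert (Heps : 0 < Rmin (eps / (L + 1)) (delta / 2)).
  { apply Rmin_pos; [apply Rdiv_lt_0_compat; [apply cond_pos | lra] | lra]. }
  assert (H1 := abs_sum_derive_0 cs es Hc (mkposreal _ Heps)).
  assert (H2 := locally_0_lt 1 Rlt_0_1).
  generalize (filter_and _ _ H1 H2); apply filter_imp; intros s [Hs Hs1]; simpl in Hs.
  set (A := abs_sum (combine (map (fun c => c s) cs) es)) in *.
  assert (Hl := Rmin_l (eps / (L + 1)) (delta / 2)).
  assert (Hr := Rmin_r (eps / (L + 1)) (delta / 2)).
  assert (Hs0 := Rabs_pos s).
  assert (A1 : A <= eps / (L + 1) * Rabs s)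
    by (eapply Rle_trans; [exact Hs | apply Rmult_le_compat_r; lra]).
  assert (A2 : A < delta).
  { apply Rle_lt_trans with (Rmin (eps / (L + 1)) (delta / 2) * 1); [ | lra].
    eapply Rle_trans; [exact Hs | apply Rmult_le_compat_l; lra]. }
  assert (A3 := H x0 (map (fun c => c s) cs) ltac:(rewrite norm_minus_diag; lra) A2).
  fold A in A3.
  assert (A4 : L * A <= eps * Rabs s).
  { assert (A0 : 0 <= A) by apply abs_sum_ge0.
    apply Rle_trans with ((L + 1) * A); [nra | ].
    assert (Ek : (L + 1) * (eps / (L + 1)) = eps) by (field; lra).
    rewrite <- Ek, Rmult_assoc.
    apply Rmult_le_compat_l; lra. }
  rewrite Rmult_0_r, !Rminus_0_r; exact (Rle_trans _ _ _ A3 A4).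
Qed.

(** The single [h12] for both mixed derivatives is the content. It comes from Schwarz's theorem for
    the function of two real variables [h (x + u e1 + v e2)], whose mixed derivatives are continuous
    because [h] is of class C^2. *)
Lemma C2_second_derivatives (D : V -> Prop) (h : V -> R) (e1 e2 : V) :
  open D -> Ck_on (W := R_NormedModule) 2 D h ->
  exists h1 h2 : V -> R,
    (forall x, D x -> is_derive (fun s : R => h (plus x (scal s e1))) 0 (h1 x)) /\
    (forall x, D x -> is_derive (fun s : R => h (plus x (scal s e2))) 0 (h2 x)) /\
    forall x, D x -> exists h11 h12 h22 : R,
      is_derive (fun s : R => h1 (plus x (scal s e1))) 0 h11 /\
      is_derive (fun s : R => h1 (plus x (scal s e2))) 0 h12 /\
      is_derive (fun s : R => h2 (plus x (scal s e1))) 0 h12 /\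
      is_derive (fun s : R => h2 (plus x (scal s e2))) 0 h22.
Proof.
  intros HD Hh.
  destruct (Hh e1) as [h1 [H1 C1]], (Hh e2) as [h2 [H2 C2]].
  destruct (C1 e1) as [h11 [H11 _]], (C1 e2) as [h12 [H12 C12]],
    (C2 e1) as [h21 [H21 C21]], (C2 e2) as [h22 [H22 _]]; simpl in C12, C21.
  exists h1, h2; split; [exact H1 | split; [exact H2 | ]]; intros x Dx.
  exists (h11 x), (h12 x), (h22 x).
  enough (E : h12 x = h21 x).
  { refine (conj (H11 x Dx) (conj (H12 x Dx) (conj _ (H22 x Dx)))).
    rewrite E; exact (H21 x Dx). }
  set (P := fun u v : R => plus x (plus (scal u e1) (scal v e2))).
  assert (P1 : forall u v t, P t v = plus (P u v) (scal (t - u) e1)).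
  { intros u v t; unfold P; rewrite <- plus_assoc; f_equal.
    rewrite (plus_comm (scal u e1)), <- plus_assoc, (plus_comm (scal t e1)); f_equal.
    rewrite <- (scal_distr_r (V := V) (u : R) (t - u)); f_equal.
    unfold plus; simpl; ring. }
  assert (P2 : forall u v t, P u t = plus (P u v) (scal (t - v) e2)).
  { intros u v t; unfold P; rewrite <- plus_assoc; f_equal.
    rewrite <- plus_assoc; f_equal.
    rewrite <- (scal_distr_r (V := V) (v : R) (t - v)); f_equal.
    unfold plus; simpl; ring. }
  assert (D1 : forall (f : V -> R) (g : V -> R) u v,
    is_derive (fun s : R => f (plus (P u v) (scal s e1))) 0 (g (P u v)) ->
    is_derive (fun t => f (P t v)) u (g (P u v))).
  { intros f g u v Hf.
    apply is_derive_ext with (fun t : R => f (plus (P u v) (scal (t - u) e1))).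
    { intros t; now rewrite (P1 u v t). }
    replace (g (P u v)) with (scal (1 : R) (g (P u v))) by apply Rmult_1_l.
    apply (is_derive_comp (fun s : R => f (plus (P u v) (scal s e1))) (fun t : R => t - u)).
    - rewrite Rminus_diag; exact Hf.
    - auto_derive; [exact I | ring]. }
  assert (D2 : forall (f : V -> R) (g : V -> R) u v,
    is_derive (fun s : R => f (plus (P u v) (scal s e2))) 0 (g (P u v)) ->
    is_derive (fun t => f (P u t)) v (g (P u v))).
  { intros f g u v Hf.
    apply is_derive_ext with (fun t : R => f (plus (P u v) (scal (t - v) e2))).
    { intros t; now rewrite (P2 u v t). }
    replace (g (P u v)) with (scal (1 : R) (g (P u v))) by apply Rmult_1_l.
    apply (is_derive_comp (fun s : R => f (plus (P u v) (scal s e2))) (fun t : R => t - v)).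
    - rewrite Rminus_diag; exact Hf.
    - auto_derive; [exact I | ring]. }
  assert (P0 : P 0 0 = x) by (unfold P; rewrite plus_assoc, !plus_scal_0; reflexivity).
  assert (near : forall (Q : V -> Prop) u0 v0, locally (P u0 v0) Q ->
                   locally_2d (fun u v => Q (P u v)) u0 v0).
  { intros Q u0 v0 HQ; apply locally_norm_le_locally in HQ; destruct HQ as [d Hd].
    assert (Hn : 0 < d / (1 + norm e1 + norm e2)).
    { apply Rdiv_lt_0_compat; [apply cond_pos | ].
      generalize (norm_ge_0 e1), (norm_ge_0 e2); lra. }
    exists (mkposreal _ Hn); simpl; intros u' v' Hu Hv.
    apply Hd; unfold ball_norm; rewrite (P2 u' v0), (P1 u0).
    eapply Rle_lt_trans; [apply norm_minus_plus_le | ].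
    eapply Rle_lt_trans; [apply Rplus_le_compat_r, norm_minus_plus_le | ].
    rewrite norm_minus_diag, Rplus_0_l.
    set (u := u' - u0) in *; set (v := v' - v0) in *.
    set (n := d / (1 + norm e1 + norm e2)) in *.
    assert (En : n * (1 + norm e1 + norm e2) = d).
    { unfold n; field; generalize (norm_ge_0 e1), (norm_ge_0 e2); lra. }
    generalize (norm_scal_le u e1), (norm_scal_le v e2), (norm_ge_0 e1), (norm_ge_0 e2).
    intros N1 N2 N3 N4.
    assert (Rabs u * norm e1 <= n * norm e1) by (apply Rmult_le_compat_r; lra).
    assert (Rabs v * norm e2 <= n * norm e2) by (apply Rmult_le_compat_r; lra).
    lra. }
  set (f := fun u v => h (P u v)).
  assert (Df1 : forall u v, D (P u v) -> is_derive (fun t => f t v) u (h1 (P u v)))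
    by (intros; apply D1; auto).
  assert (Df2 : forall u v, D (P u v) -> is_derive (fun t => f u t) v (h2 (P u v)))
    by (intros; apply D2; auto).
  assert (near1 : forall u v, D (P u v) -> locally u (fun t => D (P t v))).
  { intros u v Duv; apply (locally_2d_1d_const_y (fun a b => D (P a b))).
    apply near, HD, Duv. }
  assert (near2 : forall u v, D (P u v) -> locally v (fun t => D (P u t))).
  { intros u v Duv; apply (locally_2d_1d_const_x (fun a b => D (P a b))).
    apply near, HD, Duv. }
  assert (Df21 : forall u v, D (P u v) ->
            is_derive (fun z => Derive (fun t => f z t) v) u (h21 (P u v))).
  { intros u v Duv; apply is_derive_ext_loc with (fun t => h2 (P t v)).
    - generalize (near1 u v Duv); apply filter_imp; intros z Dz.
      symmetry; apply is_derive_unique; auto.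
    - apply D1; auto. }
  assert (Df12 : forall u v, D (P u v) ->
            is_derive (fun z => Derive (fun t => f t z) u) v (h12 (P u v))).
  { intros u v Duv; apply is_derive_ext_loc with (fun t => h1 (P u t)).
    - generalize (near2 u v Duv); apply filter_imp; intros z Dz.
      symmetry; apply is_derive_unique; auto.
    - apply D2; auto. }
  assert (DP : locally_2d (fun u v => D (P u v)) 0 0) by (apply near, HD; now rewrite P0).
  assert (cont : forall g : V -> R, continuous g x ->
            continuity_2d_pt (fun u v => g (P u v)) 0 0).
  { intros g Cg eps.
    apply (near (fun y => Rabs (g y - g (P 0 0)) < eps)); rewrite P0.
    exact (proj1 (filterlim_locally_ball_norm g (g x)) Cg eps). }
  assert (S : Derive (fun z => Derive (fun t => f z t) 0) 0 =
              Derive (fun z => Derive (fun t => f t z) 0) 0).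
  { apply Schwarz.
    - revert DP; apply locally_2d_impl, locally_2d_forall; intros u v Duv.
      refine (conj _ (conj _ (conj _ _))); eexists; eauto.
    - apply continuity_2d_pt_ext_loc with (fun u v => h21 (P u v)); [ | apply cont; auto].
      revert DP; apply locally_2d_impl, locally_2d_forall; intros u v Duv.
      symmetry; apply is_derive_unique; auto.
    - apply continuity_2d_pt_ext_loc with (fun u v => h12 (P u v)); [ | apply cont; auto].
      revert DP; apply locally_2d_impl, locally_2d_forall; intros u v Duv.
      symmetry; apply is_derive_unique; auto. }
  assert (S1 := is_derive_unique _ _ _ (Df21 0 0 ltac:(now rewrite P0))).
  assert (S2 := is_derive_unique _ _ _ (Df12 0 0 ltac:(now rewrite P0))).
  rewrite P0 in S1, S2; rewrite <- S1, <- S2; symmetry; exact S.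
Qed.

End Directional.

(** * Holomorphic slices of flow boxes *)

(** The first-order expansion of [F] at [zeta] is evaluated on the increment [s v]. The result is
    stated in real components because the complex and the real module structures on [C] differ. *)
Lemma is_derive_C_line (F : C -> C) (zeta l v : C) :
  is_derive (K := C_AbsRing) (V := C_NormedModule) F zeta l ->
  is_derive (fun s : R => fst (F (fst zeta + s * fst v, snd zeta + s * snd v))) 0
    (fst (v * l)%C) /\
  is_derive (fun s : R => snd (F (fst zeta + s * fst v, snd zeta + s * snd v))) 0
    (snd (v * l)%C).
Proof.
  intros [_ H].
  set (P := fun s : R => (fst zeta + s * fst v, snd zeta + s * snd v) : C).
  assert (P0 : P 0 = zeta) by (unfold P; destruct zeta; simpl; f_equal; ring).
  assert (EP : forall s, (P s - zeta = s * v)%C)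
    by (intros s; unfold P; destruct zeta, v; unfold Cminus, Cplus, Copp, Cmult; simpl;
        f_equal; ring).
  assert (K : forall eps : posreal, locally 0 (fun s : R =>
            Cmod (F (P s) - F (P 0) - s * (v * l))%C <= eps * Rabs s)).
  { intros eps.
    assert (Hv : 0 <= Cmod v) by apply Cmod_ge_0.
    (* The error is proportional to [|s v| = |s| |v|], so [eps] is divided by [|v|]; adding 1 covers
       [v = 0]. *)
    assert (He : 0 < eps / (1 + Cmod v)) by (apply Rdiv_lt_0_compat; [apply cond_pos | lra]).
    destruct (H zeta (fun P HP => HP) (mkposreal _ He)) as [d Hd].
    generalize (locally_0_lt (d / (1 + Cmod v))
                  ltac:(apply Rdiv_lt_0_compat; [apply cond_pos | lra])).
    apply filter_imp; intros s Hs.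
    assert (Hs1 : Rabs s * (1 + Cmod v) < d).
    { apply Rmult_lt_compat_r with (r := 1 + Cmod v) in Hs; [ | lra].
      unfold Rdiv in Hs; rewrite Rmult_assoc, Rinv_l, Rmult_1_r in Hs; lra. }
    assert (Hs0 := Rabs_pos s).
    assert (B1 : Cmod (P s - zeta)%C < d).
    { rewrite EP, Cmod_mult, Cmod_R; lra. }
    assert (B2 := Hd (P s) B1).
    change (Cmod ((F (P s) - F zeta) - (P s - zeta) * l)%C
              <= eps / (1 + Cmod v) * Cmod (P s - zeta)%C) in B2.
    rewrite EP, Cmod_mult, Cmod_R in B2.
    rewrite P0, Cmult_assoc; eapply Rle_trans; [exact B2 | ].
    assert (Ek : (1 + Cmod v) * (eps / (1 + Cmod v)) = eps) by (field; lra).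
    set (k := eps / (1 + Cmod v)) in *; rewrite <- Ek.
    replace ((1 + Cmod v) * k * Rabs s) with (k * (Rabs s * Cmod v) + k * Rabs s) by ring.
    assert (0 <= k * Rabs s) by (apply Rmult_le_pos; lra). lra. }
  split; apply is_derive_R_iff; intros eps; generalize (K eps); apply filter_imp;
    intros s Hs; rewrite Rminus_0_r; refine (Rle_trans _ _ _ _ Hs);
    (eapply Rle_trans; [ | apply Rmax_Cmod]).
  - eapply Rle_trans; [ | apply Rmax_l]; apply Req_le; f_equal.
    fold (P s) (P 0); simpl; ring.
  - eapply Rle_trans; [ | apply Rmax_r]; apply Req_le; f_equal.
    fold (P s) (P 0); simpl; ring.
Qed.

Lemma box_open : open (T := CxR) box.
Proof.
  apply open_and.
  - apply (open_comp (T := CxR) (U := C_R_NormedModule) fst unit_disc).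
    { intros x _; apply continuous_fst. }
    intros z Hz; unfold unit_disc in Hz.
    apply (locally_le_locally_norm (V := C_R_NormedModule)).
    assert (Hd : 0 < 1 - Cmod z) by lra.
    exists (mkposreal _ Hd); intros y Hy; unfold ball_norm in Hy.
    rewrite <- Cmod_norm in Hy; change (Cmod (y - z)%C < 1 - Cmod z) in Hy; unfold unit_disc.
    replace y with (z + (y - z))%C by ring.
    generalize (Cmod_triangle z (y - z)); lra.
  - apply (open_comp (T := CxR) (U := R_NormedModule) snd unit_interval).
    { intros x _; apply continuous_snd. }
    intros t Ht; unfold unit_interval in Ht.
    assert (Hd : 0 < 1 - Rabs t) by lra.
    exists (mkposreal _ Hd); intros y Hy.
    change (Rabs (y - t) < 1 - Rabs t) in Hy; unfold unit_interval.
    replace y with (t + (y - t)) by apply Rplus_minus.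
    generalize (Rabs_triang t (y - t)); lra.
Qed.

Lemma continuous_line (x e : CxR) (s : R) :
  continuous (fun s : R => plus x (scal s e) : CxR) s.
Proof.
  apply (continuous_plus (V := CxR)); [apply continuous_const | ].
  apply (continuous_scal_l (V := CxR)), continuous_id.
Qed.

Lemma box_line_near (x e : CxR) :
  box x -> locally 0 (fun s : R => box (plus x (scal s e))).
Proof.
  intros Bx; assert (Ce := continuous_line x e 0); apply Ce; cbv beta.
  rewrite plus_scal_0; apply box_open, Bx.
Qed.

Definition dir_x : CxR := ((1, 0), 0).
Definition dir_y : CxR := ((0, 1), 0).

Definition holomorphic_slices (f : C * R -> C) : Prop :=
  forall t, unit_interval t -> holomorphic_on unit_disc (fun zeta => f (zeta, t)).

(** One [l] serves all directions [v]: this order of quantifiers carries the Cauchy-Riemann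
    equations. *)
Lemma slice_line_derive (f : C * R -> C) (x : CxR) :
  holomorphic_slices f -> box x -> exists l : C, forall v : C,
    is_derive (fun s : R => Re (f (plus x (scal s ((v, 0) : CxR))))) 0 (Re (v * l)%C) /\
    is_derive (fun s : R => Im (f (plus x (scal s ((v, 0) : CxR))))) 0 (Im (v * l)%C).
Proof.
  destruct x as [zeta t]; intros Hf [Hz Ht]; simpl in Hz, Ht.
  destruct (Hf t Ht zeta Hz) as [l Hl]; exists l; intros v.
  destruct (is_derive_C_line _ _ _ v Hl) as [H1 H2].
  assert (E : forall s : R, plus ((zeta, t) : CxR) (scal s ((v, 0) : CxR)) =
                 ((fst zeta + s * fst v, snd zeta + s * snd v) : C, t)).
  { intros s; unfold plus, scal; simpl; unfold prod_plus, prod_scal, plus, scal; simpl.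
    unfold prod_plus, prod_scal, plus, scal; simpl; unfold mult; simpl.
    rewrite Rmult_0_r, Rplus_0_r; reflexivity. }
  split; [revert H1 | revert H2]; apply is_derive_ext; intros s; now rewrite E.
Qed.

(** Along a slice, [p + i q] is [f'] and [A + i B] is [f'']; the last two derivatives are the
    Cauchy-Riemann equations for [f']. They follow by differentiating those for [f] and exchanging
    mixed derivatives, so the regularity comes from the smoothness of the flow box and not from
    Cauchy's integral formula. *)
Lemma slice_jet (f : C * R -> C) :
  holomorphic_slices f ->
  Ck_on (V := CxR) (W := R_NormedModule) 2 box (fun x => Re (f x)) ->
  Ck_on (V := CxR) (W := R_NormedModule) 2 box (fun x => Im (f x)) ->
  exists p q : CxR -> R,
    (forall x : CxR, box x -> exists l : C, l = (p x, q x) /\ forall v : C,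
      is_derive (fun s : R => Re (f (plus x (scal s ((v, 0) : CxR))))) 0 (Re (v * l)%C) /\
      is_derive (fun s : R => Im (f (plus x (scal s ((v, 0) : CxR))))) 0 (Im (v * l)%C)) /\
    forall x : CxR, box x -> exists A B : R,
      is_derive (fun s : R => p (plus x (scal s dir_x))) 0 A /\
      is_derive (fun s : R => q (plus x (scal s dir_x))) 0 B /\
      is_derive (fun s : R => p (plus x (scal s dir_y))) 0 (- B) /\
      is_derive (fun s : R => q (plus x (scal s dir_y))) 0 A.
Proof.
  intros Hf Ha Hb.
  destruct (C2_second_derivatives (V := CxR) box _ dir_x dir_y box_open Ha)
    as [a1 [a2 [Ha1 [Ha2 Ha3]]]].
  destruct (C2_second_derivatives (V := CxR) box _ dir_x dir_y box_open Hb)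
    as [b1 [b2 [Hb1 [Hb2 Hb3]]]].
  assert (CR : forall x, box x -> exists l : C, l = (a1 x, b1 x) /\
             (a2 x = - b1 x /\ b2 x = a1 x) /\ forall v : C,
      is_derive (fun s : R => Re (f (plus x (scal s ((v, 0) : CxR))))) 0 (Re (v * l)%C) /\
      is_derive (fun s : R => Im (f (plus x (scal s ((v, 0) : CxR))))) 0 (Im (v * l)%C)).
  { intros x Bx; destruct (slice_line_derive f x Hf Bx) as [l Hl].
    destruct (Hl (1, 0)) as [L1 L2], (Hl (0, 1)) as [L3 L4].
    assert (U1 := is_derive_unique _ _ _ L1); assert (U2 := is_derive_unique _ _ _ L2).
    assert (U3 := is_derive_unique _ _ _ L3); assert (U4 := is_derive_unique _ _ _ L4).
    assert (V1 := is_derive_unique _ _ _ (Ha1 x Bx)).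
    assert (V2 := is_derive_unique _ _ _ (Hb1 x Bx)).
    assert (V3 := is_derive_unique _ _ _ (Ha2 x Bx)).
    assert (V4 := is_derive_unique _ _ _ (Hb2 x Bx)).
    unfold dir_x, dir_y in V1, V2, V3, V4.
    destruct l as [l1 l2]; simpl in U1, U2, U3, U4.
    assert (E1 : a1 x = l1) by (rewrite <- V1; refine (eq_trans U1 _); ring).
    assert (E2 : b1 x = l2) by (rewrite <- V2; refine (eq_trans U2 _); ring).
    assert (E3 : a2 x = - l2) by (rewrite <- V3; refine (eq_trans U3 _); ring).
    assert (E4 : b2 x = l1) by (rewrite <- V4; refine (eq_trans U4 _); ring).
    exists (l1, l2); rewrite E1, E2, E3, E4; auto. }
  exists a1, b1; split.
  { intros x Bx; destruct (CR x Bx) as [l [El [_ Hl]]]; exists l; auto. }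
  intros x Bx.
  destruct (Ha3 x Bx) as [a11 [a12 [a22 [A1 [A2 [A3 A4]]]]]].
  destruct (Hb3 x Bx) as [b11 [b12 [b22 [B1 [B2 [B3 B4]]]]]].
  assert (near := fun e => box_line_near x e Bx).
  (* The identity [b2 = a1] holds on the whole box, so it may be differentiated along [dir_x]; the
     derivative of [b2] is the mixed one. [E2] treats [a2 = - b1] in the same way. *)
  assert (E1 : b12 = a11).
  { rewrite <- (is_derive_unique _ _ _ B3); apply is_derive_unique.
    apply is_derive_ext_loc with (2 := A1).
    generalize (near dir_x); apply filter_imp; intros s Bs.
    now destruct (CR _ Bs) as [_ [_ [[_ E] _]]]. }
  assert (E2 : a12 = - b11).
  { rewrite <- (is_derive_unique _ _ _ A3); apply is_derive_unique.
    apply is_derive_ext_loc with (2 := is_derive_opp _ _ _ B1).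
    generalize (near dir_x); apply filter_imp; intros s Bs.
    now destruct (CR _ Bs) as [_ [_ [[E _] _]]]. }
  exists a11, b11; rewrite <- E2; rewrite <- E1 at 2.
  exact (conj A1 (conj B1 (conj A2 B2))).
Qed.

(** If [F' = 0], differentiating [Im G = rho (F, Re G)] in the direction where [G'] is
    imaginary gives [G' = 0], and then [psi (phi x) = x] cannot hold to first order. *)
Lemma slice_immersed (rho : C * R -> R) (phi : C * R -> C * C) (x : CxR) (l : C) :
  smooth (V := CxR) (W := R_NormedModule) rho ->
  flow_box (graph rho) phi -> box x ->
  (forall v : C,
     is_derive (fun s : R => Re (fst (phi (plus x (scal s ((v, 0) : CxR)))))) 0 (Re (v * l)%C) /\
     is_derive (fun s : R => Im (fst (phi (plus x (scal s ((v, 0) : CxR)))))) 0 (Im (v * l)%C)) ->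
  l <> 0.
Proof.
  intros Hrho [Hphi [Hhol [U [psi [HU [Hpsi [Hin Hout]]]]]]] Bx Hl Hl0.
  subst l.
  assert (Hg : holomorphic_slices (fun y => snd (phi y))) by (intros t Ht; now apply Hhol).
  destruct (slice_line_derive _ x Hg Bx) as [[l1 l2] Hm].
  set (X := fun (v : C) (s : R) => plus x (scal s ((v, 0) : CxR))).
  assert (X0 : forall v, X v 0 = x) by (intros v; apply plus_scal_0).
  assert (near : forall v, locally 0 (fun s : R => box (X v s)))
    by (intros v; apply box_line_near, Bx).
  assert (HF : forall v, is_derive (fun s => Re (fst (phi (X v s))) - Re (fst (phi x))) 0 0 /\
                         is_derive (fun s => Im (fst (phi (X v s))) - Im (fst (phi x))) 0 0).
  { intros v; destruct (Hl v) as [H1 H2]; rewrite Cmult_0_r in H1, H2.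
    split; apply is_derive_minus_const; assumption. }
  destruct (Hin x Bx) as [Ux [Sx Ix]].
  assert (Z : l1 * l1 + l2 * l2 = 0).
  (* This [v] is [i] times the conjugate of [G' = l1 + i l2], so [v G' = i |G'|^2]. In this
     direction [F] and [Re G] are stationary, hence so is [rho (F, Re G) = Im G], whose derivative
     is [|G'|^2]. *)
  { set (v := (l2, l1) : C).
    destruct (Hm v) as [H1 H2], (HF v) as [H3 H4].
    assert (E1 : Re (v * (l1, l2))%C = 0) by (unfold v; simpl; ring).
    assert (E2 : Im (v * (l1, l2))%C = l1 * l1 + l2 * l2) by (unfold v; simpl; ring).
    rewrite E1 in H1; rewrite E2 in H2; rewrite <- (is_derive_unique _ _ _ H2).
    apply is_derive_unique.
    apply is_derive_ext_loc with (fun s : R =>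
      rho (plus ((fst (phi x), Re (snd (phi x))) : CxR)
        (linear_comb (combine (map (fun c => c s)
           ((fun s => Re (fst (phi (X v s))) - Re (fst (phi x))) ::
            (fun s => Im (fst (phi (X v s))) - Im (fst (phi x))) ::
            (fun s => Re (snd (phi (X v s))) - Re (snd (phi x))) :: nil))
           (dir_x :: dir_y :: (((0, 0), 1) : CxR) :: nil))))).
    - generalize (near v); apply filter_imp; intros s Bs; cbv beta.
      destruct (Hin _ Bs) as [_ [Ss _]]; unfold graph in Ss; fold (X v s); rewrite Ss.
      f_equal; simpl; unfold plus, scal, zero, dir_x, dir_y; simpl.
      unfold prod_plus, prod_scal, prod_zero, plus, scal, zero; simpl.
      unfold prod_plus, prod_scal, prod_zero, plus, scal, zero; simpl; unfold mult; simpl.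
      destruct (phi x) as [[a b] [c d]], (phi (X v s)) as [[a' b'] [c' d']]; simpl.
      f_equal; [f_equal | ]; ring.
    - apply (C1_curve_derive_0 (fun _ => True) rho _ _ _ open_true (Hrho 1%nat) I).
      repeat apply List.Forall_cons; try apply List.Forall_nil;
        (split; [rewrite X0; apply Rminus_diag | ]); auto.
      apply is_derive_minus_const; exact H1. }
  assert (l1 = 0 /\ l2 = 0) as [-> ->] by (split; nra).
  assert (HG : is_derive (fun s => Re (snd (phi (X 1 s))) - Re (snd (phi x))) 0 0 /\
               is_derive (fun s => Im (snd (phi (X 1 s))) - Im (snd (phi x))) 0 0).
  { destruct (Hm 1) as [H1 H2]; rewrite Cmult_0_r in H1, H2.
    split; apply is_derive_minus_const; assumption. }
  destruct HG as [G1 G2], (HF 1) as [F1 F2].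
  assert (Lin : is_linear (U := CxR) (V := R_NormedModule) (fun y => Re (fst y))).
  { apply (is_linear_comp (U := CxR) (V := C_R_NormedModule) (W := R_NormedModule) fst fst);
      apply is_linear_fst. }
  (* All four real coordinates of [phi (X 1 s)] are now stationary at 0, so [psi] of this curve is
     stationary too. But [psi (phi (X 1 s)) = X 1 s], whose first coordinate moves at speed 1. *)
  assert (D0 : is_derive (fun s : R => Re (fst (psi
       (plus (phi x : CxC)
        (linear_comb (combine (map (fun c => c s)
           ((fun s => Re (fst (phi (X 1 s))) - Re (fst (phi x))) ::
            (fun s => Im (fst (phi (X 1 s))) - Im (fst (phi x))) ::
            (fun s => Re (snd (phi (X 1 s))) - Re (snd (phi x))) ::
            (fun s => Im (snd (phi (X 1 s))) - Im (snd (phi x))) :: nil))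
           ((((1, 0), (0, 0)) : CxC) :: (((0, 1), (0, 0)) : CxC) ::
            (((0, 0), (1, 0)) : CxC) :: (((0, 0), (0, 1)) : CxC) :: nil))))))) 0 0).
  { apply (C1_curve_derive_0 U (fun p => Re (fst (psi p)))); auto.
    - apply (Ck_on_linear (U := CxC) (V := CxR) (W := R_NormedModule)
               (fun y => Re (fst y))); [exact Lin | apply Hpsi].
    - repeat apply List.Forall_cons; try apply List.Forall_nil;
        (split; [rewrite X0; apply Rminus_diag | ]); auto. }
  assert (D1 : is_derive (fun s : R => Re (fst x) + s) 0 1).
  { auto_derive; [exact I | ring]. }
  assert (E : 1 = 0); [ | lra].
  rewrite <- (is_derive_unique _ _ _ D1); apply is_derive_unique.
  apply is_derive_ext_loc with (2 := D0).
  generalize (near 1); apply filter_imp; intros s Bs; cbv beta.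
  destruct (Hin _ Bs) as [_ [_ Is]].
  transitivity (Re (fst (psi (phi (X 1 s))))).
  - do 3 f_equal; simpl; unfold plus, scal, zero; simpl.
    unfold prod_plus, prod_scal, prod_zero, plus, scal, zero; simpl.
    unfold prod_plus, prod_scal, prod_zero, plus, scal, zero; simpl; unfold mult; simpl.
    destruct (phi x) as [[a b] [c d]], (phi (X 1 s)) as [[a' b'] [c' d']]; simpl.
    f_equal; f_equal; ring.
  - rewrite Is; change (fst (fst x) + s * 1 = fst (fst x) + s); ring.
Qed.

(** * Maximum principle *)

Lemma second_derivative_max (k k1 : R -> R) (k2 : R) :
  locally 0 (fun s => is_derive k s (k1 s)) -> is_derive k1 0 k2 ->
  locally 0 (fun s => k s <= k 0) -> k2 <= 0.
Proof.
  intros Hk Hk1 Hmax.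
  destruct (filter_and _ _ Hk Hmax) as [d Hd].
  assert (near : forall s, Rabs s < d -> is_derive k s (k1 s) /\ k s <= k 0).
  { intros s Hs; apply Hd; change (Rabs (s + - 0) < d); now rewrite Ropp_0, Rplus_0_r. }
  assert (Hdp := cond_pos d).
  assert (Z : k1 0 = 0).
  { assert (D0 : is_derive k 0 (k1 0)) by (apply near; rewrite Rabs_R0; exact Hdp).
    apply is_derive_Reals in D0.
    rewrite <- (derive_pt_eq_0 k 0 (k1 0) (exist _ (k1 0) D0) D0).
    apply deriv_maximum with (- d / 2) (d / 2); try lra.
    intros s S1 S2; apply near; apply Rabs_def1; lra. }
  (* If [k2 > 0], then [k1], which vanishes at 0, is positive just to the right of 0, and the mean
     value theorem puts [k] above its maximum. The tolerance [k2 / 2] leaves [k1 s] at least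
     [s k2 / 2]. *)
  apply Rnot_lt_le; intros Hp; assert (Hh : 0 < k2 / 2) by lra.
  destruct (proj1 (is_derive_R_iff k1 0 k2) Hk1 (mkposreal _ Hh)) as [r Hr].
  simpl in Hr.
  assert (pos : forall s, 0 < s < r -> 0 < k1 s).
  { intros s Hs.
    assert (Hs' : Rabs s < r) by (rewrite Rabs_pos_eq; lra).
    assert (Hb : ball 0 r s).
    { change (Rabs (s + - 0) < r); now rewrite Ropp_0, Rplus_0_r. }
    specialize (Hr s Hb); rewrite Z, !Rminus_0_r, (Rabs_pos_eq s) in Hr by lra.
    apply Rabs_le_between in Hr.
    assert (0 < s * k2) by (apply Rmult_lt_0_compat; lra). lra. }
  assert (Hrp := cond_pos r).
  set (s := Rmin d r / 2).
  assert (Hs : 0 < s) by (unfold s; generalize (Rmin_pos d r Hdp Hrp); lra).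
  assert (Hs1 : s < d) by (unfold s; generalize (Rmin_l d r), (Rmin_pos d r Hdp Hrp); lra).
  assert (Hs2 : s < r) by (unfold s; generalize (Rmin_r d r), (Rmin_pos d r Hdp Hrp); lra).
  destruct (MVT_cor2 k k1 0 s Hs) as [c [Ec Hc]].
  { intros c Hc; apply is_derive_Reals, near; apply Rabs_def1; lra. }
  assert (Hks : k s <= k 0) by (apply near; apply Rabs_def1; lra).
  assert (0 < k1 c * (s - 0)) by (apply Rmult_lt_0_compat; [apply pos | ]; lra).
  lra.
Qed.

(** The second derivative test for the barrier along one real line of a leaf, written out: [a + i b]
    is [F - z0], [c + i d] is [G - w0], and the left side of the conclusion is [k''(0)]. The
    explicit form allows the tests in two directions to be added algebraically. *)
Lemma barrier_line (a b c d a1 b1 c1 d1 : R -> R) (a2 b2 c2 d2 eta : R) :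
  locally 0 (fun s => is_derive a s (a1 s) /\ is_derive b s (b1 s) /\
                      is_derive c s (c1 s) /\ is_derive d s (d1 s)) ->
  is_derive a1 0 a2 -> is_derive b1 0 b2 -> is_derive c1 0 c2 -> is_derive d1 0 d2 ->
  0 < a 0 * a 0 + b 0 * b 0 -> 0 < c 0 * c 0 + d 0 * d 0 ->
  (let N s := a s * a s + b s * b s in
   let k s := - ln (c s * c s + d s * d s) - eta * (ln (N s) - / N s) in
   locally 0 (fun s => k s <= k 0)) ->
  let N := a 0 * a 0 + b 0 * b 0 in
  let N1 := 2 * (a 0 * a1 0 + b 0 * b1 0) in
  let N2 := 2 * (a1 0 * a1 0 + b1 0 * b1 0 + a 0 * a2 + b 0 * b2) in
  let P := c 0 * c 0 + d 0 * d 0 in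
  let P1 := 2 * (c 0 * c1 0 + d 0 * d1 0) in
  let P2 := 2 * (c1 0 * c1 0 + d1 0 * d1 0 + c 0 * c2 + d 0 * d2) in
  - (P2 / P - P1 * P1 / (P * P))
  - eta * (N2 / N - N1 * N1 / (N * N) + N2 / (N * N) - 2 * (N1 * N1) / (N * N * N)) <= 0.
Proof.
  intros Hd Ha Hb Hc Hdd HN HP Hmax N N1 N2 P P1 P2.
  set (k1 := fun s =>
    - (2 * (c s * c1 s + d s * d1 s) / (c s * c s + d s * d s))
    - eta * (2 * (a s * a1 s + b s * b1 s) / (a s * a s + b s * b s)
             + 2 * (a s * a1 s + b s * b1 s) / ((a s * a s + b s * b s) ^ 2))).
  refine (second_derivative_max _ k1 _ _ _ Hmax).
  - destruct (locally_singleton _ _ Hd) as [A0 [B0 [C0 D0]]].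
    assert (CN : continuous (fun s => a s * a s + b s * b s) 0).
    { apply (ex_derive_continuous (K := R_AbsRing) (V := R_NormedModule)).
      auto_derive; repeat split; eexists; eassumption. }
    assert (CP : continuous (fun s => c s * c s + d s * d s) 0).
    { apply (ex_derive_continuous (K := R_AbsRing) (V := R_NormedModule)).
      auto_derive; repeat split; eexists; eassumption. }
    assert (LN := CN _ (open_gt 0 _ HN)); assert (LP := CP _ (open_gt 0 _ HP)).
    unfold filtermap in LN, LP.
    generalize (filter_and _ _ Hd (filter_and _ _ LN LP)); apply filter_imp.
    intros s [[As [Bs [Cs Ds]]] [Ns Ps]].
    assert (EA := is_derive_unique (fun x : R => a x) _ _ As);
    assert (EB := is_derive_unique (fun x : R => b x) _ _ Bs).
    assert (EC := is_derive_unique (fun x : R => c x) _ _ Cs);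
    assert (ED := is_derive_unique (fun x : R => d x) _ _ Ds).
    unfold k1; auto_derive.
    + repeat split; try (eexists; eassumption); try lra.
    + rewrite EA, EB, EC, ED; field; split; lra.
  - destruct (locally_singleton _ _ Hd) as [A0 [B0 [C0 D0]]].
    assert (EA := is_derive_unique (fun x : R => a x) _ _ A0);
    assert (EB := is_derive_unique (fun x : R => b x) _ _ B0).
    assert (EC := is_derive_unique (fun x : R => c x) _ _ C0);
    assert (ED := is_derive_unique (fun x : R => d x) _ _ D0).
    assert (EA1 := is_derive_unique (fun x : R => a1 x) _ _ Ha);
    assert (EB1 := is_derive_unique (fun x : R => b1 x) _ _ Hb).
    assert (EC1 := is_derive_unique (fun x : R => c1 x) _ _ Hc);
    assert (ED1 := is_derive_unique (fun x : R => d1 x) _ _ Hdd).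
    unfold k1; auto_derive.
    + repeat split; try (eexists; eassumption); try lra.
      apply Rmult_integral_contrapositive_currified; nra.
    + rewrite EA, EB, EC, ED, EA1, EB1, EC1, ED1; unfold N, N1, N2, P, P1, P2; field.
      split; lra.
Qed.

(** [s q''(s) + q'(s) = - 1 / s ^ 2] for [q s = ln s - 1 / s], so that the Laplacian of
    [- eta q(|F|^2)] is positive wherever [F' <> 0]. *)
Lemma barrier_laplacian (a b c d p q p' q' A B A' B' eta : R) :
  let N := a * a + b * b in
  let P := c * c + d * d in
  0 < N -> 0 < P -> 0 < eta ->
  (let N1 := 2 * (a * p + b * q) in
   let N2 := 2 * (p * p + q * q + a * A + b * B) in
   let P1 := 2 * (c * p' + d * q') in
   let P2 := 2 * (p' * p' + q' * q' + c * A' + d * B') in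
   - (P2 / P - P1 * P1 / (P * P))
   - eta * (N2 / N - N1 * N1 / (N * N) + N2 / (N * N) - 2 * (N1 * N1) / (N * N * N)) <= 0) ->
  (let N1 := 2 * (a * - q + b * p) in
   let N2 := 2 * (- q * - q + p * p + a * - A + b * - B) in
   let P1 := 2 * (c * - q' + d * p') in
   let P2 := 2 * (- q' * - q' + p' * p' + c * - A' + d * - B') in
   - (P2 / P - P1 * P1 / (P * P))
   - eta * (N2 / N - N1 * N1 / (N * N) + N2 / (N * N) - 2 * (N1 * N1) / (N * N * N)) <= 0) ->
  p = 0 /\ q = 0.
Proof.
  intros N P HN HP Heta H1 H2; cbv zeta in H1, H2.
  (* The sum is the Laplacian. The terms in [P] cancel because [ln |G - w0|^2] is harmonic, and so
     do those from [ln N]; what is left is [4 eta |F'|^2 / N^2]. *)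
  assert (H := Rplus_le_compat _ _ _ _ H1 H2).
  match type of H with ?x <= _ => assert (E : x = 4 * eta * (p * p + q * q) / (N * N)) end.
  { unfold N, P in *; field; split; lra. }
  rewrite E in H.
  assert (HNN : 0 < / (N * N)) by (apply Rinv_0_lt_compat; nra).
  assert (Hpq : p * p + q * q <= 0).
  { apply Rnot_lt_le; intros Hpq.
    assert (0 < 4 * eta * (p * p + q * q) / (N * N)); [ | lra].
    unfold Rdiv; repeat apply Rmult_lt_0_compat; lra. }
  split; nra.
Qed.

Definition sqdist (p q : C) : R :=
  (Re p - Re q) * (Re p - Re q) + (Im p - Im q) * (Im p - Im q).

(** At fixed [z], maximising over [u] amounts to minimising the distance from [w0] to the slice, so
    no nearest point has to be selected. Squared distances only double the logarithms. *)
Definition barrier (rho : C * R -> R) (z0 w0 : C) (eta : R) (x : CxR) : R :=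
  - ln (sqdist (snd x, rho x) w0) - eta * (ln (sqdist (fst x) z0) - / sqdist (fst x) z0).

(** A local maximum on the graph is one on the leaf through the point. There the Laplacian would be
    at most 0, which by [barrier_laplacian] forces [F' = 0], against [slice_immersed]. *)
Lemma barrier_no_local_max (rho : C * R -> R) (z0 w0 : C) (eta : R) (y : CxR) :
  smooth (V := CxR) (W := R_NormedModule) rho ->
  levi_flat (graph rho) -> 0 < eta ->
  0 < sqdist (fst y) z0 -> 0 < sqdist (snd y, rho y) w0 ->
  ~ locally y (fun x => barrier rho z0 w0 eta x <= barrier rho z0 w0 eta y).
Proof.
  intros Hrho [At [HA1 [HA2 _]]] Heta HN HP Hmax.
  assert (Hmax' : locally ((fst y, snd y) : CxR)
             (fun x => barrier rho z0 w0 eta x <= barrier rho z0 w0 eta y))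
    by (destruct y; exact Hmax).
  assert (Sy : graph rho (fst y, (snd y, rho y))) by (destruct y; reflexivity).
  destruct (HA2 _ Sy : exists phi (x : CxR), At phi /\ box x /\ phi x = _) as
    [phi [x [Hphi [Bx Ex]]]].
  apply HA1 in Hphi; clear HA1 HA2.
  assert (Hphi' := Hphi); destruct Hphi' as [Sphi [Hhol [U [psi [_ [_ [Hin _]]]]]]].
  assert (LF : is_linear (U := CxC) (V := C_R_NormedModule) fst) by apply is_linear_fst.
  assert (LG : is_linear (U := CxC) (V := C_R_NormedModule) snd) by apply is_linear_snd.
  assert (LR : is_linear (U := C_R_NormedModule) (V := R_NormedModule) Re)
    by apply is_linear_fst.
  assert (LI : is_linear (U := C_R_NormedModule) (V := R_NormedModule) Im)
    by apply is_linear_snd.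
  destruct (slice_jet (fun x => fst (phi x))) as [p [q [J1 J2]]].
  { intros t Ht; now apply Hhol. }
  { exact (Ck_on_linear _ _ _ _ (is_linear_comp _ _ LF LR) (Sphi 2%nat)). }
  { exact (Ck_on_linear _ _ _ _ (is_linear_comp _ _ LF LI) (Sphi 2%nat)). }
  destruct (slice_jet (fun x => snd (phi x))) as [p' [q' [J1' J2']]].
  { intros t Ht; now apply Hhol. }
  { exact (Ck_on_linear _ _ _ _ (is_linear_comp _ _ LG LR) (Sphi 2%nat)). }
  { exact (Ck_on_linear _ _ _ _ (is_linear_comp _ _ LG LI) (Sphi 2%nat)). }
  destruct (J2 x Bx) as [A [B [P1 [P2 [P3 P4]]]]].
  destruct (J2' x Bx) as [A' [B' [Q1 [Q2 [Q3 Q4]]]]].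
  assert (near := fun e => box_line_near x e Bx).
  (* The maximality is transported to the leaf through the coordinates [(F, Re G)]; since the leaf
     lies in the graph, [rho (F, Re G)] is [Im G] and the barrier becomes a function of [F] and
     [G]. *)
  assert (max : forall e : CxR, locally 0 (fun s : R =>
     let X := phi (plus x (scal s e)) in
     - ln (sqdist (snd X) w0) - eta * (ln (sqdist (fst X) z0) - / sqdist (fst X) z0)
       <= barrier rho z0 w0 eta y)).
  { intros e.
    assert (Cy : continuous (fun s : R => (fst (phi (plus x (scal s e))),
                                           Re (snd (phi (plus x (scal s e))))) : CxR) 0).
    { apply (continuous_comp (V := CxR) (fun s : R => plus x (scal s e))
               (fun x => (fst (phi x), Re (snd (phi x))) : CxR)); [apply continuous_line | ].
      rewrite plus_scal_0.
      apply (continuous_comp (V := CxC) phi (fun X => (fst X, Re (snd X)) : CxR)).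
      - exact (Sphi 0%nat x Bx).
      - apply (linear_cont (U := CxC) (V := CxR)).
        apply (is_linear_prod (U := C_R_NormedModule) (V := R_NormedModule)); [exact LF | ].
        exact (is_linear_comp _ _ LG LR). }
    generalize (filter_and _ _ (near e)
      (Cy _ ltac:(cbv beta; rewrite plus_scal_0, Ex; exact Hmax'))).
    apply filter_imp; intros s [Bs Hs]; cbv zeta.
    destruct (Hin _ Bs) as [_ [Ss _]]; unfold graph in Ss.
    refine (Rle_trans _ _ _ _ Hs); apply Req_le; unfold barrier; simpl.
    rewrite <- Ss; now destruct (snd (phi (plus x (scal s e)))). }
  destruct (J1 x Bx) as [l [El Hl]].
  destruct (slice_immersed rho phi x l Hrho Hphi Bx Hl); rewrite El; clear l El Hl.
  set (a := Re (fst y) - Re z0) in *; set (b := Im (fst y) - Im z0) in *.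
  set (c := snd y - Re w0) in *; set (d := rho y - Im w0) in *.
  assert (line : forall v : C, locally 0 (fun s : R =>
     let X := plus x (scal s ((v, 0) : CxR)) in
     is_derive (fun s : R => Re (fst (phi (plus x (scal s ((v, 0) : CxR))))) - Re z0) s
       (Re (v * (p X, q X))%C) /\
     is_derive (fun s : R => Im (fst (phi (plus x (scal s ((v, 0) : CxR))))) - Im z0) s
       (Im (v * (p X, q X))%C) /\
     is_derive (fun s : R => Re (snd (phi (plus x (scal s ((v, 0) : CxR))))) - Re w0) s
       (Re (v * (p' X, q' X))%C) /\
     is_derive (fun s : R => Im (snd (phi (plus x (scal s ((v, 0) : CxR))))) - Im w0) s
       (Im (v * (p' X, q' X))%C))).
  { intros v; generalize (near (v, 0)); apply filter_imp; intros s Bs; cbv zeta.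
    destruct (J1 _ Bs) as [l [-> Hl]], (J1' _ Bs) as [l' [-> Hl']].
    destruct (Hl v) as [H1 H2], (Hl' v) as [H3 H4].
    refine (conj _ (conj _ (conj _ _))); apply is_derive_minus_const.
    - exact (is_derive_along (W := R_NormedModule) (fun x => Re (fst (phi x))) _ _ _ _ H1).
    - exact (is_derive_along (W := R_NormedModule) (fun x => Im (fst (phi x))) _ _ _ _ H2).
    - exact (is_derive_along (W := R_NormedModule) (fun x => Re (snd (phi x))) _ _ _ _ H3).
    - exact (is_derive_along (W := R_NormedModule) (fun x => Im (snd (phi x))) _ _ _ _ H4). }
  assert (Z : p x = 0 /\ q x = 0); [ | destruct Z as [-> ->]; reflexivity].
  assert (M1 := max dir_x); assert (M2 := max dir_y).
  assert (Re1 : forall a b : R, Re ((1, 0) * (a, b))%C = a) by (intros; simpl; ring).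
  assert (Im1 : forall a b : R, Im ((1, 0) * (a, b))%C = b) by (intros; simpl; ring).
  assert (Rei : forall a b : R, Re ((0, 1) * (a, b))%C = - b) by (intros; simpl; ring).
  assert (Imi : forall a b : R, Im ((0, 1) * (a, b))%C = a) by (intros; simpl; ring).
  assert (L1 : locally 0 (fun s : R =>
    is_derive (fun s : R => Re (fst (phi (plus x (scal s dir_x)))) - Re z0) s
      (p (plus x (scal s dir_x))) /\
    is_derive (fun s : R => Im (fst (phi (plus x (scal s dir_x)))) - Im z0) s
      (q (plus x (scal s dir_x))) /\
    is_derive (fun s : R => Re (snd (phi (plus x (scal s dir_x)))) - Re w0) s
      (p' (plus x (scal s dir_x))) /\
    is_derive (fun s : R => Im (snd (phi (plus x (scal s dir_x)))) - Im w0) s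
      (q' (plus x (scal s dir_x))))).
  { generalize (line (1, 0)); apply filter_imp; intros s [H1 [H2 [H3 H4]]].
    refine (conj _ (conj _ (conj _ _)));
      [ refine (eq_ind _ (fun d => is_derive _ s d) H1 _ _)
      | refine (eq_ind _ (fun d => is_derive _ s d) H2 _ _)
      | refine (eq_ind _ (fun d => is_derive _ s d) H3 _ _)
      | refine (eq_ind _ (fun d => is_derive _ s d) H4 _ _) ];
      first [exact (Re1 _ _) | exact (Im1 _ _)]. }
  assert (L2 : locally 0 (fun s : R =>
    is_derive (fun s : R => Re (fst (phi (plus x (scal s dir_y)))) - Re z0) s
      (- q (plus x (scal s dir_y))) /\
    is_derive (fun s : R => Im (fst (phi (plus x (scal s dir_y)))) - Im z0) s
      (p (plus x (scal s dir_y))) /\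
    is_derive (fun s : R => Re (snd (phi (plus x (scal s dir_y)))) - Re w0) s
      (- q' (plus x (scal s dir_y))) /\
    is_derive (fun s : R => Im (snd (phi (plus x (scal s dir_y)))) - Im w0) s
      (p' (plus x (scal s dir_y))))).
  { generalize (line (0, 1)); apply filter_imp; intros s [H1 [H2 [H3 H4]]].
    refine (conj _ (conj _ (conj _ _)));
      [ refine (eq_ind _ (fun d => is_derive _ s d) H1 _ _)
      | refine (eq_ind _ (fun d => is_derive _ s d) H2 _ _)
      | refine (eq_ind _ (fun d => is_derive _ s d) H3 _ _)
      | refine (eq_ind _ (fun d => is_derive _ s d) H4 _ _) ];
      first [exact (Rei _ _) | exact (Imi _ _)]. }
  apply (barrier_laplacian a b c d (p x) (q x) (p' x) (q' x) A B A' B' eta HN HP Heta).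
  - generalize (barrier_line _ _ _ _ _ _ _ _ A B A' B' eta L1 P1 P2 Q1 Q2).
    cbv beta zeta; rewrite plus_scal_0, Ex; intros H; apply H; auto.
  (* Along [dir_y] the first derivative of a slice is [i F'], that is [(- q, p)], and the second is
     [i^2 F'' = - F'']. *)
  - generalize (barrier_line _ _ _ _ _ _ _ _ (- A) (- B) (- A') (- B') eta L2
      (is_derive_opp _ _ _ P4) P3 (is_derive_opp _ _ _ Q4) Q3).
    cbv beta zeta; rewrite plus_scal_0, Ex; intros H; apply H; auto.
Qed.

(** * Distance to the slices of the graph *)

Lemma CxR_locally_box (t : CxR) (P : CxR -> Prop) :
  locally t P -> exists d : R, 0 < d /\ forall x : CxR,
    Rabs (Re (fst x) - Re (fst t)) < d -> Rabs (Im (fst x) - Im (fst t)) < d ->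
    Rabs (snd x - snd t) < d -> P x.
Proof.
  intros [d Hd]; exists d; split; [apply cond_pos | ]; intros x H1 H2 H3.
  apply Hd; split; [split | ]; assumption.
Qed.

(** Compactness of a cube in the three real coordinates: a locally valid [d] becomes uniform,
    because the least of finitely many values still satisfies the monotone [Q]. *)
Lemma lebesgue_number (B : R) (Q : CxR -> R -> Prop) :
  (forall x d d', d' <= d -> Q x d -> Q x d') ->
  (forall t : CxR, exists d, 0 < d /\ locally t (fun x => Q x d)) ->
  exists d, 0 < d /\ forall x : CxR,
    Rabs (Re (fst x)) <= B -> Rabs (Im (fst x)) <= B -> Rabs (snd x) <= B -> Q x d.
Proof.
  intros Hmon Hloc.
  assert (Hloc' : forall t : Compactness.Tn 3 R, exists d : posreal, forall x : CxR,
    Rabs (Re (fst x) - fst t) < d -> Rabs (Im (fst x) - fst (snd t)) < d ->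
    Rabs (snd x - fst (snd (snd t))) < d -> Q x d).
  { intros [a [b [c []]]]; destruct (Hloc ((a, b), c)) as [d1 [Hd1 H1]].
    apply CxR_locally_box in H1; destruct H1 as [d2 [Hd2 H2]].
    (* [compactness_value] works with a single gauge, so one number must be both the radius of the
       neighbourhood and the value put into [Q]. *)
    exists (mkposreal _ (Rmin_pos _ _ Hd1 Hd2)); simpl; intros x X1 X2 X3.
    generalize (Rmin_l d1 d2), (Rmin_r d1 d2); intros.
    apply Hmon with d1; [assumption | ].
    apply H2; simpl; lra. }
  set (delta := fun t => proj1_sig (constructive_indefinite_description _ (Hloc' t))).
  destruct (compactness_value 3 (- B, (- B, (- B, tt))) (B, (B, (B, tt))) delta) as [d Hd].
  exists d; split; [apply cond_pos | ]; intros x X1 X2 X3.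
  apply Rabs_le_between in X1, X2, X3.
  apply NNPP; intros HQ; apply (Hd (Re (fst x), (Im (fst x), (snd x, tt)))).
  { simpl; auto. }
  intros [t [_ [Hc Hdt]]]; apply HQ.
  apply Hmon with (delta t); [exact Hdt | ].
  revert Hc; unfold delta.
  destruct (constructive_indefinite_description _ (Hloc' t)) as [d' H']; simpl.
  destruct t as [a [b [c []]]]; intros [C1 [C2 [C3 _]]]; apply H'; assumption.
Qed.

Lemma continuous_sqdist_fst (z0 : C) (t : CxR) :
  continuous (fun x : CxR => sqdist (fst x) z0) t.
Proof.
  unfold sqdist.
  assert (C1 : continuous (fun x : CxR => Re (fst x) - Re z0) t).
  { apply (continuous_minus (V := R_NormedModule)); [ | apply continuous_const].
    apply (continuous_comp (U := CxR) (V := C_R_NormedModule) (W := R_NormedModule) fst Re).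
    - apply (linear_cont (U := CxR) (V := C_R_NormedModule)), is_linear_fst.
    - apply (linear_cont (U := C_R_NormedModule) (V := R_NormedModule)), is_linear_fst. }
  assert (C2 : continuous (fun x : CxR => Im (fst x) - Im z0) t).
  { apply (continuous_minus (V := R_NormedModule)); [ | apply continuous_const].
    apply (continuous_comp (U := CxR) (V := C_R_NormedModule) (W := R_NormedModule) fst Im).
    - apply (linear_cont (U := CxR) (V := C_R_NormedModule)), is_linear_fst.
    - apply (linear_cont (U := C_R_NormedModule) (V := R_NormedModule)), is_linear_snd. }
  apply (continuous_plus (V := R_NormedModule));
    apply (continuous_mult (K := R_AbsRing)); assumption.
Qed.

Lemma continuous_sqdist_graph (rho : C * R -> R) (w0 : C) (t : CxR) :
  smooth (V := CxR) (W := R_NormedModule) rho ->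
  continuous (fun x : CxR => sqdist (snd x, rho x) w0) t.
Proof.
  intros Hrho; unfold sqdist; simpl.
  assert (C1 : continuous (fun x : CxR => snd x - Re w0) t).
  { apply (continuous_minus (V := R_NormedModule)); [ | apply continuous_const].
    apply (linear_cont (U := CxR) (V := R_NormedModule)), is_linear_snd. }
  assert (C2 : continuous (fun x : CxR => rho x - Im w0) t).
  { apply (continuous_minus (V := R_NormedModule)); [ | apply continuous_const].
    exact (Hrho 0%nat t I). }
  apply (continuous_plus (V := R_NormedModule)
           (fun x : CxR => (snd x - Re w0) * (snd x - Re w0))
           (fun x : CxR => (rho x - Im w0) * (rho x - Im w0)));
    apply (continuous_mult (U := CxR) (K := R_AbsRing)); assumption.
Qed.

Lemma continuous_gt_locally (f : CxR -> R) (t : CxR) (c : R) :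
  continuous f t -> c < f t -> locally t (fun x => c < f x).
Proof. intros Cf H; exact (Cf _ (open_gt c _ H)). Qed.

Lemma continuous_lt_locally (f : CxR -> R) (t : CxR) (c : R) :
  continuous f t -> f t < c -> locally t (fun x => f x < c).
Proof. intros Cf H; exact (Cf _ (open_lt c _ H)). Qed.

Lemma continuous_barrier (rho : C * R -> R) (z0 w0 : C) (eta : R) (t : CxR) :
  smooth (V := CxR) (W := R_NormedModule) rho ->
  0 < sqdist (fst t) z0 -> 0 < sqdist (snd t, rho t) w0 ->
  continuous (barrier rho z0 w0 eta) t.
Proof.
  intros Hrho HN HP; unfold barrier.
  assert (CN := continuous_sqdist_fst z0 t).
  assert (CP := continuous_sqdist_graph rho w0 t Hrho).
  apply (continuous_minus (V := R_NormedModule)).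
  - apply (continuous_opp (V := R_NormedModule)).
    apply (continuous_comp (V := R_UniformSpace) (fun x : CxR => sqdist (snd x, rho x) w0) ln);
      auto using continuous_ln.
  - apply (continuous_mult (K := R_AbsRing) (fun _ => eta)); [apply continuous_const | ].
    apply (continuous_minus (V := R_NormedModule)).
    + apply (continuous_comp (V := R_UniformSpace) (fun x : CxR => sqdist (fst x) z0) ln);
        auto using continuous_ln.
    + apply (continuous_comp (V := R_UniformSpace) (fun x : CxR => sqdist (fst x) z0) Rinv);
        [exact CN | apply continuous_Rinv; lra].
Qed.

Lemma sqdist_ge0 (p q : C) : 0 <= sqdist p q.
Proof.
  generalize (Rle_0_sqr (Re p - Re q)), (Rle_0_sqr (Im p - Im q)).
  unfold sqdist, Rsqr; lra.
Qed.

Lemma sqdist_ge_Re (p q : C) (B : R) :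
  Rabs (Re q) + B < Rabs (Re p) -> 0 <= B -> B * B <= sqdist p q.
Proof.
  intros H HB; unfold sqdist.
  assert (Hd : B <= Rabs (Re p - Re q)).
  { generalize (Rabs_triang_inv (Re p) (Re q)); lra. }
  fold (Rsqr (Re p - Re q)); rewrite Rsqr_abs.
  generalize (Rle_0_sqr (Im p - Im q)), (Rmult_le_compat _ _ _ _ HB HB Hd Hd).
  unfold Rsqr; lra.
Qed.

Lemma sqdist_ge_Im (p q : C) (B : R) :
  Rabs (Im q) + B < Rabs (Im p) -> 0 <= B -> B * B <= sqdist p q.
Proof.
  intros H HB; unfold sqdist.
  assert (Hd : B <= Rabs (Im p - Im q)).
  { generalize (Rabs_triang_inv (Im p) (Im q)); lra. }
  fold (Rsqr (Im p - Im q)); rewrite Rsqr_abs.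
  generalize (Rle_0_sqr (Re p - Re q)), (Rmult_le_compat _ _ _ _ HB HB Hd Hd).
  unfold Rsqr; lra.
Qed.

(** Lower semicontinuity in [z] of the distance from [w0] to the slice. The slice is not compact,
    but its points with large [|u|] are far from [w0] anyway, and a cube contains the others. *)
Lemma graph_dist_near (rho : C * R -> R) (z0 w0 : C) (c c' : R) :
  smooth (V := CxR) (W := R_NormedModule) rho -> c < c' -> 0 < c' ->
  (forall u, c' <= sqdist (u, rho (z0, u)) w0) ->
  exists r, 0 < r /\ forall x : CxR, sqdist (fst x) z0 <= r ->
    c <= sqdist (snd x, rho x) w0.
Proof.
  intros Hrho Hc Hc' H.
  (* Outside the cube, either [|z - z0|^2 >= 4], too large for [r <= 1], or the squared distance to
     [w0] is at least [(1 + c')^2 > c]. *)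
  set (B := Rabs (Re z0) + Rabs (Im z0) + Rabs (Re w0) + 2 + c').
  destruct (lebesgue_number B (fun x d =>
     sqdist (fst x) z0 <= d -> c <= sqdist (snd x, rho x) w0)) as [d [Hd HQ]].
  - intros x d d' Hdd Hx Hx'; apply Hx; lra.
  - intros t; destruct (Rle_lt_or_eq_dec _ _ (sqdist_ge0 (fst t) z0)) as [Ht | Ht].
    (* Off the slice over [z0] the property holds vacuously near [t]. *)
    + exists (sqdist (fst t) z0 / 2); split; [lra | ].
      assert (Ht2 : sqdist (fst t) z0 / 2 < sqdist (fst t) z0) by lra.
      generalize (continuous_gt_locally _ t _ (continuous_sqdist_fst z0 t) Ht2).
      apply filter_imp; intros x Hx Hx'; lra.
    + exists 1; split; [lra | ].
      assert (Et : t = (z0, snd t)).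
      { destruct t as [[a b] u], z0 as [a0 b0]; unfold sqdist in Ht; simpl in *.
        destruct (Rplus_sqr_eq_0 _ _ (eq_sym Ht)) as [Ha Hb].
        now rewrite (Rminus_diag_uniq _ _ Ha), (Rminus_diag_uniq _ _ Hb). }
      assert (Ht2 : c < sqdist (snd t, rho t) w0).
      { rewrite Et; simpl; eapply Rlt_le_trans; [exact Hc | apply H]. }
      generalize (continuous_gt_locally _ t _ (continuous_sqdist_graph rho w0 t Hrho) Ht2).
      apply filter_imp; intros x Hx _; lra.
  - exists (Rmin d 1); split; [apply Rmin_pos; lra | ]; intros x Hx.
    assert (M1 := Rmin_l d 1); assert (M2 := Rmin_r d 1).
    assert (A1 := Rabs_pos (Re z0)); assert (A2 := Rabs_pos (Im z0)).
    assert (A3 := Rabs_pos (Re w0)).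
    destruct (Rle_or_lt (Rabs (Re (fst x))) B) as [B1 | B1].
    2: { assert (G := sqdist_ge_Re (fst x) z0 2 ltac:(unfold B in B1; lra) ltac:(lra)); lra. }
    destruct (Rle_or_lt (Rabs (Im (fst x))) B) as [B2 | B2].
    2: { assert (G := sqdist_ge_Im (fst x) z0 2 ltac:(unfold B in B2; lra) ltac:(lra)); lra. }
    destruct (Rle_or_lt (Rabs (snd x)) B) as [B3 | B3].
    + apply HQ; auto; lra.
    + assert (G : (1 + c') * (1 + c') <= sqdist (snd x, rho x) w0).
      { apply sqdist_ge_Re; [ | lra].
        change (Rabs (Re w0) + (1 + c') < Rabs (snd x)); unfold B in B3; lra. }
      generalize (Rle_0_sqr c'); unfold Rsqr; lra.
Qed.

(** Maximum principle on [|z - z0|^2 >= r]: the barrier, of size [eta], forces the maximum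
    to be attained, and [eta] is small enough for the value at [x1] to exceed those on
    the inner boundary. *)
Lemma graph_dist_slice_le (rho : C * R -> R) (z0 w0 : C) (m eps : R) (x1 : CxR) :
  smooth (V := CxR) (W := R_NormedModule) rho -> levi_flat (graph rho) ->
  0 < m -> (forall x : CxR, m <= sqdist (snd x, rho x) w0) -> 0 < eps ->
  exists u, sqdist (u, rho (z0, u)) w0 < sqdist (snd x1, rho x1) w0 + eps.
Proof.
  intros Hrho Hflat Hm HD Heps; apply NNPP; intros Hno.
  set (D := fun x : CxR => sqdist (snd x, rho x) w0) in *.
  set (N := fun x : CxR => sqdist (fst x) z0).
  assert (HD1 : m <= D x1) by apply HD.
  assert (Hall : forall u, D x1 + eps <= sqdist (u, rho (z0, u)) w0).
  { intros u; apply Rnot_lt_le; intros Hu; apply Hno; now exists u. }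
  clear Hno.
  destruct (graph_dist_near rho z0 w0 (D x1 + eps / 2) (D x1 + eps) Hrho) as [r [Hr Hnear]];
    try lra; [exact Hall | ].
  assert (HN1 : r < N x1).
  { apply Rnot_le_lt; intros H; specialize (Hnear x1 H); unfold D in Hnear; lra. }
  set (q := fun s => ln s - / s).
  assert (qmono : forall s t, 0 < s -> s <= t -> q s <= q t).
  { intros s t Hs Hst; unfold q.
    assert (ln s <= ln t) by (apply ln_le; lra).
    assert (/ t <= / s) by (apply Rinv_le_contravar; lra). lra. }
  set (L := q (N x1) - q r).
  assert (HL : 0 <= L) by (unfold L; generalize (qmono r (N x1)); lra).
  set (g := ln (D x1 + eps / 2) - ln (D x1)).
  assert (Hg : 0 < g).
  { unfold g; generalize (ln_increasing (D x1) (D x1 + eps / 2)); lra. }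
  (* The value at [x1] exceeds the bound on the inner boundary exactly when [eta * L < g]; the added
     1 makes this strict and covers [L = 0]. *)
  set (eta := g / (L + 1)).
  assert (Heta : 0 < eta) by (apply Rdiv_lt_0_compat; lra).
  assert (HetaL : eta * (L + 1) = g) by (unfold eta; field; lra).
  set (K := barrier rho z0 w0 eta).
  assert (EK : forall x, K x = - ln (D x) - eta * q (N x)) by reflexivity.
  assert (Hbd : - ln (D x1 + eps / 2) - eta * q r < K x1).
  { rewrite EK; unfold g in HetaL; unfold L in HetaL; lra. }
  assert (lnD : forall x, ln m <= ln (D x)) by (intros x; apply ln_le; [lra | apply HD]).
  assert (qN : forall x, r <= N x -> eta * q r <= eta * q (N x)).
  { intros x Hx; apply Rmult_le_compat_l; [lra | apply qmono; lra]. }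
  set (E := fun y => exists x, r <= N x /\ y = K x).
  destruct (completeness E) as [S [HS1 HS2]].
  { exists (- ln m - eta * q r); intros y [x [Hx ->]]; rewrite EK.
    generalize (lnD x), (qN x Hx); lra. }
  { exists (K x1), x1; split; [lra | reflexivity]. }
  assert (HSx : forall x, r <= N x -> K x <= S) by (intros x Hx; apply HS1; now exists x).
  assert (HK1 : K x1 <= S) by (apply HSx; lra).
  assert (Kcont : forall t, 0 < N t -> continuous K t).
  { intros t Ht; apply continuous_barrier; auto.
    generalize (HD t); unfold D; lra. }
  (* An attained supremum is excluded in the interior by [barrier_no_local_max] and on the inner
     boundary by [Hbd]. If it is not attained, [K] stays below [S] by a fixed amount on a cube and
     below [K x1 - 1] outside it, so [S] is not the least upper bound. *)
  destruct (classic (exists t, r <= N t /\ K t = S)) as [[t [Ht Et]] | Hno].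
  - destruct (Rle_lt_or_eq_dec _ _ Ht) as [Ht1 | Ht1].
    + apply (barrier_no_local_max rho z0 w0 eta t); auto.
      * apply Rlt_trans with r; assumption.
      * generalize (HD t); unfold D; lra.
      * generalize (continuous_gt_locally _ t _ (continuous_sqdist_fst z0 t) Ht1).
        apply filter_imp; intros x Hx; fold K; rewrite Et; apply HSx; unfold N; lra.
    + assert (HDt : D x1 + eps / 2 <= D t) by (apply Hnear; unfold N in Ht1; lra).
      assert (ln (D x1 + eps / 2) <= ln (D t)) by (apply ln_le; lra).
      rewrite EK, <- Ht1 in Et; lra.
  (* The first entry is solved for the region where [|z|] is large and the barrier term pushes [K]
     down ([HT1]), the second for the region where [|u|] is large and [- ln D] does ([HT2]). *)
  - set (T := Rmax (1 + (1 - K x1 - ln m) / eta) (1 - K x1 - eta * q r)).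
    assert (HT1 : - ln m - eta * (T - 1) <= K x1 - 1).
    { assert (H := Rmax_l (1 + (1 - K x1 - ln m) / eta) (1 - K x1 - eta * q r)); fold T in H.
      assert (H' : eta * ((1 - K x1 - ln m) / eta) = 1 - K x1 - ln m) by (field; lra).
      assert (eta * ((1 - K x1 - ln m) / eta) <= eta * (T - 1))
        by (apply Rmult_le_compat_l; lra). lra. }
    assert (HT2 : - T - eta * q r <= K x1 - 1).
    { assert (H := Rmax_r (1 + (1 - K x1 - ln m) / eta) (1 - K x1 - eta * q r)); fold T in H.
      lra. }
    set (B := Rabs (Re z0) + Rabs (Im z0) + Rabs (Re w0) + (1 + exp T)).
    assert (HeT := exp_pos T).
    assert (A1 := Rabs_pos (Re z0)); assert (A2 := Rabs_pos (Im z0)).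
    assert (A3 := Rabs_pos (Re w0)).
    assert (Sq : exp T < (1 + exp T) * (1 + exp T)).
    { generalize (Rle_0_sqr (exp T)); unfold Rsqr; lra. }
    assert (farN : forall x, (1 + exp T) * (1 + exp T) <= N x -> K x <= K x1 - 1).
    { intros x Hx; rewrite EK.
      (* Comparing at a point that is at least 1 bounds the term [/ s] of [q] by 1, whatever the
         sign of [T]; this is the 1 in [T - 1]. *)
      assert (q (Rmax 1 (exp T)) <= q (N x)).
      { apply qmono; [generalize (Rmax_l 1 (exp T)); lra | apply Rmax_lub].
        - generalize (Rle_0_sqr (exp T)); unfold Rsqr; lra.
        - lra. }
      assert (T - 1 <= q (Rmax 1 (exp T))).
      { unfold q; assert (T <= ln (Rmax 1 (exp T))).
        { rewrite <- (ln_exp T) at 1; apply ln_le; [lra | apply Rmax_r]. }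
        assert (/ Rmax 1 (exp T) <= / 1).
        { apply Rinv_le_contravar; [lra | apply Rmax_l]. }
        lra. }
      assert (eta * (T - 1) <= eta * q (N x)) by (apply Rmult_le_compat_l; lra).
      generalize (lnD x); lra. }
    destruct (lebesgue_number B (fun x d => r <= N x -> K x <= S - d)) as [d [Hd HQ]].
    + intros x d d' Hdd Hx Hx'; specialize (Hx Hx'); lra.
    + intros t; destruct (Rlt_or_le (N t) r) as [Ht | Ht].
      * exists 1; split; [lra | ].
        generalize (continuous_lt_locally _ t _ (continuous_sqdist_fst z0 t) Ht).
        apply filter_imp; intros x Hx Hx'; unfold N in Hx'; lra.
      * assert (HKt : K t < S).
        { destruct (Rle_lt_or_eq_dec _ _ (HSx t Ht)) as [H | H]; [exact H | ].
          destruct Hno; now exists t. }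
        exists ((S - K t) / 2); split; [lra | ].
        assert (Ct : continuous K t) by (apply Kcont; lra).
        assert (HKt2 : K t < S - (S - K t) / 2) by lra.
        generalize (continuous_lt_locally _ t _ Ct HKt2).
        apply filter_imp; intros x Hx _; lra.
    + assert (Hlub : S <= S - Rmin d 1); [ | generalize (Rmin_pos d 1 Hd Rlt_0_1); lra].
      apply HS2; intros y [x [Hx ->]].
      assert (M1 := Rmin_l d 1); assert (M2 := Rmin_r d 1).
      enough (K x <= S - d \/ K x <= K x1 - 1) by lra.
      destruct (Rle_or_lt (Rabs (Re (fst x))) B) as [B1 | B1].
      2: { right; apply farN, sqdist_ge_Re; [unfold B in B1 | ]; lra. }
      destruct (Rle_or_lt (Rabs (Im (fst x))) B) as [B2 | B2].
      2: { right; apply farN, sqdist_ge_Im; [unfold B in B2 | ]; lra. }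
      destruct (Rle_or_lt (Rabs (snd x)) B) as [B3 | B3]; [left; now apply HQ | right].
      assert (HDx : (1 + exp T) * (1 + exp T) <= D x).
      { apply (sqdist_ge_Re (snd x, rho x) w0); [ | lra].
        change (Rabs (Re w0) + (1 + exp T) < Rabs (snd x)); unfold B in B3; lra. }
      assert (T <= ln (D x)).
      { rewrite <- (ln_exp T); apply ln_le; lra. }
      rewrite EK; generalize (qN x Hx); lra.
Qed.

Lemma Rabs_lt_of_sqr_lt (a t : R) : 0 <= t -> a * a < t * t -> Rabs a < t.
Proof.
  intros Ht H; rewrite <- (Rabs_pos_eq t Ht); apply Rsqr_lt_abs_0; exact H.
Qed.

(** The proof shows [rho (z0, us) = sigma], the top of the closed set [T] above [us], while
    [rho (z1, us) <= sigma] by definition. Equality of the two values follows on exchanging [z0] and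
    [z1]. *)
Lemma levi_flat_bounded_const (rho : C * R -> R) (M : R) :
  smooth (V := CxR) (W := R_NormedModule) rho -> levi_flat (graph rho) ->
  (forall x, Rabs (rho x) <= M) ->
  forall z0 z1 u, rho (z1, u) <= rho (z0, u).
Proof.
  intros Hrho Hflat HM z0 z1 us.
  set (T := fun v => forall eps, 0 < eps ->
              exists x : CxR, sqdist (snd x, rho x) (us, v) < eps).
  assert (T1 : T (rho (z1, us))).
  { intros eps Heps; exists (z1, us); unfold sqdist, Re, Im; simpl.
    rewrite !Rminus_diag; lra. }
  destruct (completeness T) as [sigma [HS1 HS2]]; [ | now exists (rho (z1, us)) | ].
  (* The bound on [rho] makes [sigma] finite: a point at height [v > M] is at distance at least
     [v - M] from every slice. *)
  { exists M; intros v Hv; apply Rnot_lt_le; intros HMv.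
    destruct (Hv ((v - M) * (v - M)) ltac:(apply Rmult_lt_0_compat; lra)) as [x Hx].
    unfold sqdist, Re, Im in Hx; simpl in Hx.
    assert (Hb := proj2 (proj1 (Rabs_le_between _ _) (HM x))).
    apply (Rlt_irrefl ((v - M) * (v - M))); eapply Rle_lt_trans; [ | exact Hx].
    assert (Hpq : forall p q s, 0 <= s -> q <= - s -> s * s <= p * p + q * q).
    { intros p q s Hs Hq; generalize (Rle_0_sqr p); unfold Rsqr; nra. }
    apply Hpq; lra. }
  assert (Hsig : rho (z1, us) <= sigma) by now apply HS1.
  enough (rho (z0, us) = sigma) by lra.
  apply NNPP; intros Hne.
  set (e := Rabs (rho (z0, us) - sigma) / 2).
  assert (He : 0 < e) by (unfold e; generalize (Rabs_pos_lt (rho (z0, us) - sigma)); lra).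
  assert (Cr := Hrho 0%nat (z0, us) I).
  destruct (CxR_locally_box _ _
    (proj1 (filterlim_locally_ball_norm (T := CxR) (U := R_NormedModule)
       (F := locally ((z0, us) : CxR)) rho (rho (z0, us))) Cr (mkposreal e He)))
    as [d [Hd Hcont]].
  (* A point of the slice over [z0] will be found within [4 t] of [us + i (sigma + t)]. Then
     [4 t < d] allows continuity at [us] to be used, and [4 t + t + e < 2 e] contradicts the choice
     of [e]. *)
  set (t := Rmin d e / 6).
  assert (Hm := Rmin_pos d e Hd He); assert (Hl := Rmin_l d e); assert (Hr := Rmin_r d e).
  assert (Ht : 0 < t) by (unfold t; lra).
  assert (Htt : 0 < t * t) by (apply Rmult_lt_0_compat; lra).
  (* The height [sigma + t] exceeds the supremum, so the point is outside the closure of the union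
     of the slices and may serve as [w0]. *)
  assert (far : exists m, 0 < m /\ forall x : CxR, m <= sqdist (snd x, rho x) (us, sigma + t)).
  { apply NNPP; intros Hno.
    assert (HT : T (sigma + t)); [ | specialize (HS1 _ HT); lra].
    intros eps Heps; apply NNPP; intros Hno'; apply Hno; exists eps; split; [exact Heps | ].
    intros x; apply Rnot_lt_le; intros Hx; apply Hno'; now exists x. }
  destruct far as [m [Hm0 Hfar]].
  assert (Hv : exists v, T v /\ sigma - t < v).
  { apply NNPP; intros Hno; assert (sigma <= sigma - t); [ | lra].
    apply HS2; intros v Hv; apply Rnot_lt_le; intros Hlt; apply Hno; now exists v. }
  destruct Hv as [v [Tv Hv]]; assert (Hv' := HS1 v Tv).
  assert (Hx : exists (z : C) (u : R), sqdist (u, rho (z, u)) (us, v) < t * t).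
  { destruct (Tv (t * t) Htt) as [[z u] H]; now exists z, u. }
  destruct Hx as [z2 [u2 Hx1]].
  destruct (graph_dist_slice_le rho z0 (us, sigma + t) m (t * t) (z2, u2) Hrho Hflat Hm0 Hfar Htt)
    as [u Hu].
  unfold sqdist, Re, Im in Hu, Hx1; simpl in Hu, Hx1.
  assert (B1 : (rho (z2, u2) - (sigma + t)) * (rho (z2, u2) - (sigma + t)) <=
               2 * ((rho (z2, u2) - v) * (rho (z2, u2) - v)) + 8 * (t * t)).
  { assert (Hab : forall a b, 0 <= b <= 2 * t ->
              (a - b) * (a - b) <= 2 * (a * a) + 8 * (t * t)).
    { intros a b Hb; generalize (Rle_0_sqr (a + b)); unfold Rsqr.
      assert (b * b <= (2 * t) * (2 * t)) by (apply Rmult_le_compat; lra).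
      intros; lra. }
    replace (rho (z2, u2) - (sigma + t)) with ((rho (z2, u2) - v) - (sigma + t - v)) by ring.
    apply Hab; lra. }
  assert (P1 := Rle_0_sqr (u2 - us)); assert (P2 := Rle_0_sqr (rho (z2, u2) - v)).
  assert (P3 := Rle_0_sqr (u - us)).
  assert (P4 := Rle_0_sqr (rho (z0, u) - (sigma + t))).
  unfold Rsqr in P1, P2, P3, P4.
  (* The squared distance from [w0] is below [2 t^2 + 8 t^2] for the point over [z2], and
     [graph_dist_slice_le] adds at most [t^2]: in total [11 t^2 < (4 t)^2]. *)
  assert (Bu : Rabs (u - us) < 4 * t)  by (apply Rabs_lt_of_sqr_lt; lra).
  assert (Br : Rabs (rho (z0, u) - (sigma + t)) < 4 * t) by (apply Rabs_lt_of_sqr_lt; lra).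
  assert (Bc : Rabs (rho (z0, u) - rho (z0, us)) < e).
  { apply (Hcont (z0, u)); simpl; rewrite ?Rminus_diag, ?Rabs_R0; unfold t in Bu; lra. }
  assert (Rabs (rho (z0, us) - sigma) < 2 * e); [ | unfold e in *; lra].
  apply Rabs_def2 in Br; apply Rabs_def2 in Bc; unfold t in *; apply Rabs_def1; lra.
Qed.

(** * Foliation by lines *)

Definition line_chart (varrho : R -> R) (c : C) (r u0 : R) (x : C * R) : C * C :=
  ((c + r * fst x)%C, (u0 + snd x, varrho (u0 + snd x))).

Definition line_chart_inv (c : C) (r u0 : R) (p : C * C) : C * R :=
  ((RtoC (/ r) * (fst p - c))%C, Re (snd p) - u0).

Lemma line_chart_smooth (varrho : R -> R) (c : C) (r u0 : R) :
  smooth (V := R_NormedModule) (W := R_NormedModule) varrho ->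
  smooth_on (V := CxR) (W := CxC) box (line_chart varrho c r u0).
Proof.
  intros Hv k; unfold line_chart.
  assert (Cs : forall x : CxR, continuous (fun x : CxR => u0 + snd x : R_NormedModule) x).
  { intros x; apply (continuous_plus (V := R_NormedModule)); [apply continuous_const | ].
    apply (linear_cont (U := CxR) (V := R_NormedModule)), is_linear_snd. }
  assert (As : forall (x v : CxR) (t : R),
    u0 + snd (plus x (scal t v)) = plus (u0 + snd x) (scal t (snd v))).
  { intros x v t; unfold plus, scal; simpl; unfold mult, plus, scal; simpl.
    unfold mult; simpl; ring. }
  apply (Ck_on_pair (U := CxR) (V := C_R_NormedModule) (W := C_R_NormedModule)).
  - apply (Ck_on_affine (U := CxR) (V := C_R_NormedModule)) with
      (fun v => scal r (fst v)).
    + intros x; apply continuous_ext with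
        (fun x : CxR => plus (c : C_R_NormedModule) (scal r (fst x))).
      { intros [[a b] s]; destruct c; unfold plus, scal; simpl.
        unfold prod_plus, prod_scal, plus, scal, Cplus, Cmult; simpl.
        unfold mult; simpl; f_equal; ring. }
      apply (continuous_plus (V := C_R_NormedModule)); [apply continuous_const | ].
      apply (continuous_scal_r (V := C_R_NormedModule)).
      apply (linear_cont (U := CxR) (V := C_R_NormedModule)), is_linear_fst.
    + intros [[a b] s] [[a' b'] s'] t; destruct c; unfold plus, scal; simpl.
      unfold prod_plus, prod_scal, plus, scal, Cplus, Cmult; simpl.
      unfold prod_plus, prod_scal, plus, scal, Cplus, Cmult; simpl.
      unfold mult; simpl; f_equal; ring.
  - apply (Ck_on_pair (U := CxR) (V := R_NormedModule) (W := R_NormedModule)).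
    + apply (Ck_on_affine (U := CxR) (V := R_NormedModule)) with (fun v => snd v); auto.
    + apply (Ck_on_precomp_affine (U := CxR) (V := R_NormedModule) (W := R_NormedModule)
               k (fun _ => True) box (fun x => u0 + snd x) (fun v => snd v) varrho); auto.
Qed.

Lemma line_chart_inv_affine (c : C) (r u0 : R) :
  (forall p : CxC, continuous (line_chart_inv c r u0 : CxC -> CxR) p) /\
  (forall (p v : CxC) (t : R), (line_chart_inv c r u0 (plus p (scal t v)) : CxR) =
     plus (line_chart_inv c r u0 p : CxR)
          (scal t ((scal (/ r) (fst v), Re (snd v)) : CxR))).
Proof.
  split.
  - intros p; apply continuous_ext with (fun p : CxC =>
      plus ((scal (/ r) (opp c : C_R_NormedModule), - u0) : CxR)
           ((scal (/ r) (fst p), Re (snd p)) : CxR)).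
    { intros [[a b] [a' b']]; destruct c; unfold line_chart_inv, plus, scal, opp; simpl.
      unfold prod_plus, prod_scal, prod_opp, plus, scal, opp, Cminus, Cplus, Copp, Cmult; simpl.
      unfold prod_plus, prod_scal, prod_opp, plus, scal, opp, Cminus, Cplus, Copp, Cmult; simpl.
      unfold mult; simpl; f_equal; [f_equal | ]; ring. }
    apply (continuous_plus (V := CxR)); [apply continuous_const | ].
    apply (linear_cont (U := CxC) (V := CxR)).
    apply (is_linear_prod (T := CxC) (U := C_R_NormedModule) (V := R_NormedModule)).
    + apply (is_linear_comp (U := CxC) (V := C_R_NormedModule) (W := C_R_NormedModule)
               fst (fun z => scal (/ r) z)); [apply is_linear_fst | ].
      exact (is_linear_scal_r (K := R_AbsRing) (V := C_R_NormedModule) (/ r) Rmult_comm).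
    + apply (is_linear_comp (U := CxC) (V := C_R_NormedModule) (W := R_NormedModule) snd Re);
        [apply is_linear_snd | apply is_linear_fst].
  - intros [[a b] [a' b']] [[x y] [x' y']] t; destruct c.
    unfold line_chart_inv, plus, scal; simpl.
    unfold prod_plus, prod_scal, plus, scal, Cminus, Cplus, Copp, Cmult; simpl.
    unfold prod_plus, prod_scal, plus, scal, Cminus, Cplus, Copp, Cmult; simpl.
    unfold mult; simpl; f_equal; [f_equal | ]; ring.
Qed.

(** The inverse ignores [Im w], which on the graph is recovered as [varrho (Re w)]. It is thus
    affine on all of [C * C], and the preimage of the box serves as the open set. *)
Lemma line_chart_flow_box (varrho : R -> R) (rho : C * R -> R) (c : C) (r u0 : R) :
  smooth (V := R_NormedModule) (W := R_NormedModule) varrho ->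
  (forall z u, rho (z, u) = varrho u) -> 0 < r ->
  flow_box (graph rho) (line_chart varrho c r u0).
Proof.
  intros Hv Hrho Hr.
  assert (Hr' : RtoC r <> 0) by (intros H; apply RtoC_inj in H; lra).
  destruct (line_chart_inv_affine c r u0) as [Hc Ha].
  split; [now apply line_chart_smooth | split].
  - intros t _; split; intros z _.
    + exists (RtoC r); split; [apply (is_linear_scal_l (V := C_NormedModule)) | ].
      intros x _ eps; apply filter_forall; intros y.
      unfold line_chart; simpl.
      match goal with |- norm ?a <= _ => replace a with (zero : C_NormedModule) end.
      * rewrite norm_zero; apply Rmult_le_pos; [apply Rlt_le, cond_pos | apply norm_ge_0].
      * unfold minus, plus, opp, scal, zero; simpl; unfold mult; simpl; ring.
    + exact (ex_derive_const (K := C_AbsRing) (V := C_NormedModule)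
               ((u0 + t, varrho (u0 + t)) : C) z).
  - exists (fun p => box (line_chart_inv c r u0 p)), (line_chart_inv c r u0).
    split; [ | split; [ | split]].
    + apply (open_comp (T := CxC) (U := CxR)); [intros x _; apply Hc | apply box_open].
    + intros k; eapply (Ck_on_affine (U := CxC) (V := CxR)); [exact Hc | exact Ha].
    + intros [z t] Hx.
      assert (E : line_chart_inv c r u0 (line_chart varrho c r u0 (z, t)) = (z, t)).
      { unfold line_chart, line_chart_inv; simpl; f_equal; [ | ring].
        rewrite RtoC_inv by lra; field; exact Hr'. }
      rewrite E; split; [exact Hx | split; [ | reflexivity]].
      unfold graph, line_chart; simpl; now rewrite Hrho.
    + intros [z [u v]] HU HX; split; [exact HU | ].
      unfold graph in HX; simpl in HX; rewrite Hrho in HX.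
      unfold line_chart, line_chart_inv; simpl.
      replace (u0 + (u - u0)) with u by ring; rewrite HX, RtoC_inv by lra.
      f_equal; field; exact Hr'.
Qed.

(** The radius [r] is arbitrary, so that any two points of a line lie in one plaque. *)
Definition line_atlas (varrho : R -> R) (phi : C * R -> C * C) : Prop :=
  exists (c : C) (r u0 : R), 0 < r /\ phi = line_chart varrho c r u0.

Lemma line_atlas_foliation (varrho : R -> R) (rho : C * R -> R) :
  smooth (V := R_NormedModule) (W := R_NormedModule) varrho ->
  (forall z u, rho (z, u) = varrho u) ->
  complex_foliation (graph rho) (line_atlas varrho).
Proof.
  intros Hv Hrho; split; [ | split].
  - intros phi [c [r [u0 [Hr ->]]]]; now apply line_chart_flow_box.
  - intros [z [u v]] HX; unfold graph in HX; simpl in HX; rewrite Hrho in HX.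
    exists (line_chart varrho z 1 u), (RtoC 0, 0); split; [ | split].
    + exists z, 1, u; split; [lra | reflexivity].
    + split; unfold unit_disc, unit_interval; simpl; rewrite ?Cmod_0, ?Rabs_R0; lra.
    + unfold line_chart; simpl; rewrite Rplus_0_r, HX; f_equal; ring.
  - intros phi phi' zeta t zeta' t' [c [r [u0 [Hr ->]]]] [c' [r' [u0' [Hr' ->]]]] _ [Bz' _] E.
    unfold line_chart in E; simpl in E; injection E as E1 E2 E3 _.
    simpl in Bz'; unfold unit_disc in Bz'.
    (* In the second chart the point with parameter [eta] has parameter
       [zeta' + (r / r') (eta - zeta)]; this radius keeps it in the unit disc. *)
    exists (r' * (1 - Cmod zeta') / r); split.
    { apply Rdiv_lt_0_compat; [apply Rmult_lt_0_compat | ]; lra. }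
    intros eta _ Heta.
    assert (Hr0 : RtoC r' <> 0).
    { intros Hz; apply RtoC_inj in Hz; lra. }
    exists (zeta' + r / r' * (eta - zeta))%C; split.
    + unfold unit_disc; eapply Rle_lt_trans; [apply Cmod_triangle | ].
      rewrite !Cmod_mult, Cmod_div, !Cmod_R, !Rabs_pos_eq by (assumption || lra).
      assert (Hlt : r / r' * Cmod (eta - zeta) < r / r' * (r' * (1 - Cmod zeta') / r)).
      { apply Rmult_lt_compat_l; [apply Rdiv_lt_0_compat; lra | exact Heta]. }
      replace (r / r' * (r' * (1 - Cmod zeta') / r)) with (1 - Cmod zeta') in Hlt
        by (field; lra).
      lra.
    + unfold line_chart; simpl; rewrite E3; f_equal.
      transitivity ((c + r * zeta) + r * (eta - zeta))%C; [ring | ].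
      assert (E1' : (c + r * zeta = c' + r' * zeta')%C)
        by (apply injective_projections; assumption).
      rewrite E1'; field; exact Hr0.
Qed.

Lemma line_atlas_leaf (varrho : R -> R) (p q : C * C) :
  leaf (line_atlas varrho) p q -> snd q = snd p.
Proof.
  induction 1 as
    [p q [phi [t [[c [r [u0 [_ ->]]]] [_ [[z [_ ->]] [z' [_ ->]]]]]]] | p q s _ H1 _ H2].
  - reflexivity.
  - now rewrite H2.
Qed.

Lemma line_atlas_leaf_line (varrho : R -> R) (rho : C * R -> R) (p : C * C) :
  (forall z u, rho (z, u) = varrho u) -> graph rho p ->
  complex_line (leaf (line_atlas varrho) p).
Proof.
  intros Hrho; destruct p as [z [u v]]; intros HX.
  unfold graph in HX; simpl in HX; rewrite Hrho in HX; subst v.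
  exists (RtoC 0, (u, varrho u)), (RtoC 1, RtoC 0); split.
  { intros H; injection H; lra. }
  intros q; split.
  - intros Hq; apply line_atlas_leaf in Hq; destruct q as [z' w']; simpl in Hq; subst w'.
    exists z'; simpl; f_equal; apply injective_projections; simpl; ring.
  - intros [zeta ->]; apply t_step.
    replace (fst (RtoC 0, ((u, varrho u) : C)) + zeta * fst (RtoC 1, RtoC 0))%C with zeta
      by (apply injective_projections; simpl; ring).
    replace (snd (RtoC 0, ((u, varrho u) : C)) + zeta * snd (RtoC 1, RtoC 0))%C
      with ((u, varrho u) : C) by (apply injective_projections; simpl; ring).
    (* With this radius the chart centred at [z] also contains the point over [zeta], so a single
       plaque joins the two. *)
    set (r := 1 + Cmod (zeta - z)).
    assert (Hz : 0 <= Cmod (zeta - z)) by apply Cmod_ge_0.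
    assert (Hr : 0 < r) by (unfold r; lra).
    assert (Hr0 : RtoC r <> 0) by (intros H; apply RtoC_inj in H; lra).
    exists (line_chart varrho z r u), 0; split; [ | split; [ | split]].
    + exists z, r, u; auto.
    + unfold unit_interval; rewrite Rabs_R0; lra.
    + exists (RtoC 0); split; [unfold unit_disc; rewrite Cmod_0; lra | ].
      unfold line_chart; simpl; rewrite Rplus_0_r; f_equal; ring.
    + exists ((zeta - z) / r)%C; split.
      * unfold unit_disc; rewrite Cmod_div, Cmod_R, Rabs_pos_eq by (assumption || lra).
        apply Rmult_lt_reg_r with r; [exact Hr | ].
        unfold Rdiv; rewrite Rmult_assoc, Rinv_l by lra; unfold r; lra.
      * unfold line_chart; simpl; rewrite Rplus_0_r; f_equal; field; exact Hr0.
Qed.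

Theorem theorem2p1 (rho : C * R -> R)
  (rho_smooth : smooth (V := CxR) (W := R_NormedModule) rho)
  (S_levi_flat : levi_flat (graph rho))
  (M : R) (rho_bounded : forall x : C * R, Rabs (rho x) <= M) :
  foliated_by_complex_lines (graph rho)
  /\ exists varrho : R -> R,
       smooth (V := R_NormedModule) (W := R_NormedModule) varrho
       /\ forall (z : C) (u : R), rho (z, u) = varrho u.
Proof.
  set (varrho := fun u => rho (RtoC 0, u)).
  assert (Hrho : forall z u, rho (z, u) = varrho u).
  (* The two inequalities are the same lemma with the slices over [z] and over 0 exchanged. *)
  { intros z u; apply Rle_antisym; eapply levi_flat_bounded_const; eauto. }
  assert (Hv : smooth (V := R_NormedModule) (W := R_NormedModule) varrho).
  { intros k.
    apply (Ck_on_precomp_affine (U := R_NormedModule) (V := CxR) (W := R_NormedModule)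
             k (fun _ => True) (fun _ => True) (fun u => (RtoC 0, u))
             (fun v => (RtoC 0, v)) rho); auto.
    - intros x; apply (continuous_comp_2 (V := C_R_NormedModule) (W := R_NormedModule)
        (X := CxR) (fun _ => RtoC 0) (fun u => u) (fun z u => (z, u))).
      + apply continuous_const.
      + apply continuous_id.
      + apply continuous_ext with (fun x => x); [now intros [] | apply continuous_id].
    - intros x v t; unfold plus, scal; simpl; unfold prod_plus, prod_scal, plus, scal; simpl.
      unfold prod_plus, prod_scal, plus, scal, RtoC; simpl; unfold mult; simpl.
      f_equal; f_equal; ring. }
  split; [ | now exists varrho].
  exists (line_atlas varrho); split; [now apply line_atlas_foliation | ].
  intros p Hp; now apply line_atlas_leaf_line with rho.
Qed.
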